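(* Suppose Assumption B holds: $E[J^3]<\infty$, $E[I^3]<\infty$, $E[X]=1$, $E[X^4]<\infty$. Suppose the Markov chain $(Y_n)$ is irreducible and aperiodic, let $\theta=\frac{2}{\sigma^2}(\mu+\nu-\rho)<0$, let $\pi$ be the stationary distribution of $(Y_n)$, and let $\bar\pi=\sum_{k\ge0}k\,\pi(k)$. If $-1\le\theta<0$, then $\bar\pi=\infty$. If $\theta<-1$, then $\bar\pi<\infty$ and $$\bar\pi=\frac{-\theta\mu}{4(\theta+1)(\nu-\rho)}\left(\theta\sigma^2-2\mu+\frac{4\nu}{\theta}+\frac{2\,\mathrm{Var}(I)}{\mu}-\frac{4\,\mathrm{Var}(I+J+K)}{\sigma^2\theta}\right).$$
   Context: Let $I,J,K,X$ be $\mathbb N_0$-valued random variables, $\mathbb N_0=\{0,1,2,\dots\}$, with $P(J>0)=1$ and $K\sim\mathrm{Geo}(1-p)$ for some $0<p<1$, i.e. $P(K=k)=(1-p)p^k$ for $k\ge 0$; in $\mathrm{Var}(I+J+K)$ the variables $I,J,K$ are independent. Let $(I_n)$, $(J_n)$, $(K_n)$, $(X_{m,n})$ ($n\ge0$, $m\ge1$) be i.i.d. copies of $I,J,K,X$ respectively, all jointly independent. The branching process $(Y_n)_{n\ge 0}$ is the Markov chain on $\mathbb N_0$ with given $Y_0$ and $$Y_{n+1}=\Bigl(J_n+\sum_{m=1}^{Y_n+I_n-K_n}X_{m,n}\Bigr)\mathbf 1_{\{K_n<Y_n+I_n\}},\qquad n\ge 0.$$ Notation: $\mu=E[I]$, $\nu=E[J]$,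 $\rho=E[K]=p/(1-p)$, $\sigma^2=\mathrm{Var}(X)$, and it is assumed throughout that $\sigma^2>0$. When $\theta<0$ the chain is positive recurrent, so $\pi$ exists and is unique. *)

(* Defs.v *)
From HB Require Import structures.
From mathcomp Require Export all_boot all_order all_algebra finmap.
From mathcomp Require Export all_classical all_reals all_analysis.

Set Implicit Arguments.
Unset Strict Implicit.
Unset Printing Implicit Defensive.

Import Order.TTheory GRing.Theory Num.Theory.

Local Open Scope classical_set_scope.
Local Open Scope ring_scope.

Section RandomVariables.
Context {d : measure_display} {T : measurableType d} {R : realType}.
Variable P : probability T R.

Definition same_law (U V : {RV P >-> nat}) :=
  forall A : set nat, distribution P U A = distribution P V A.

Definition mutually_independent (idx : choiceType)
    (U : idx -> {RV P >-> nat}) :=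
  forall (S : {fset idx}) (A : idx -> set nat),
    P (\bigcap_(i in [set` S]) (U i @^-1` A i)) =
    (\prod_(i <- S) P (U i @^-1` A i))%E.

Definition geometric_law (p : R) (K : {RV P >-> nat}) :=
  forall k : nat, P [set w | K w = k] = ((1 - p) * p ^+ k)%:E.

Definition moment (k : nat) (U : T -> nat) : \bar R :=
  ('E_P[fun w => ((U w)%:R ^+ k)%R])%E.

Definition var (U : T -> nat) : \bar R := ('V_P[fun w => (U w)%:R%R])%E.

End RandomVariables.

Section BranchingProcess.
Context {d : measure_display} {T : measurableType d} {R : realType}.
Variable P : probability T R.
Variables (I_ J_ K_ : nat -> {RV P >-> nat}) (X_ : nat -> nat -> {RV P >-> nat}).

(* The second index of X_ is the time n; the first one is shifted by one, so
   that X_ m n stands for the variable written X_{m+1,n}. *)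
Definition driving_family (i : (nat + nat + nat + nat * nat)%type) : {RV P >-> nat} :=
  match i with
  | inl (inl (inl n)) => I_ n
  | inl (inl (inr n)) => J_ n
  | inl (inr n) => K_ n
  | inr (m, n) => X_ m n
  end.

Fixpoint branching (Y0 : T -> nat) (n : nat) (w : T) : nat :=
  if n is n'.+1 then
    let s := (branching Y0 n' w + I_ n' w)%N in
    if (K_ n' w < s)%N
    then (J_ n' w + \sum_(m < s - K_ n' w) X_ m n' w)%N
    else 0%N
  else Y0 w.

(* As the driving variables are independent of the initial state, the
   probability of Y_n = z given Y_0 = y is that of Y_n = z for the process
   started from the constant y. *)
Definition branching_trans (n y z : nat) : \bar R :=
  P [set w | branching (fun=> y) n w = z].

End BranchingProcess.

(* In these definitions, p n y z is the n-step transition probability from y to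
   z of a Markov chain on nat. *)
Section MarkovChain.
Context {R : realType}.
Variable p : nat -> nat -> nat -> \bar R.

Definition irreducible := forall y z, exists n, (0 < p n y z)%E.

(* gcd {n >= 1 | p n y y > 0} = 1 for all y *)
Definition aperiodic := forall y k : nat,
  (forall n, (0 < n)%N -> (0 < p n y y)%E -> (k %| n)%N) -> k = 1%N.

Definition stationary (pi : probability nat R) := forall z : nat,
  pi [set z] = (\sum_(0 <= y <oo) pi [set y] * p 1 y z)%E.

End MarkovChain.

Definition mean {R : realType} (pi : probability nat R) : \bar R :=
  (\sum_(0 <= k <oo) k%:R%:E * pi [set k])%E.

(* Main.v *)
Require Import Defs.
From mathcomp Require Import measurable_realfun.
From mathcomp Require Import ring lra zify.

Set Implicit Arguments.
Unset Strict Implicit.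
Unset Printing Implicit Defensive.

Import Order.TTheory GRing.Theory Num.Theory.
Import numFieldNormedType.Exports.

Local Open Scope classical_set_scope.
Local Open Scope ring_scope.

(** Let Z y be the state reached in one step from the state y.  The geometric
    law of K has no memory: on the event K >= y + I the overshoot K - (y + I)
    is again distributed as K.  With s(y) = P(K < y + I), the probability that
    the population is not wiped out, this gives the exact identities
      E (Z y) = y + mu - (rho - nu) s(y),
      E ((Z y)^2) = y^2 + beta y + c0 + c1 s(y),
      where beta = 2 (mu + nu - rho) + sigma^2 = sigma^2 (theta + 1),
    for explicit constants c0 and c1 (one_step_mean, one_step_moment2).  So the
    sign of theta + 1 is the sign of the drift of y^2 at large y, and
    everything follows from testing stationarity against functions close to
    y and y^2.

    - If theta < -1, the drift of y^2 is at most C - |beta| y.  Integrated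
      against pi, with y^2 replaced by its minimum with a large constant to make
      it integrable, this bounds the mean of pi (mean_finite).

    - If the mean of pi is finite, the drift of y and the drift of y^2 both
      integrate to 0 (drift_mean, drift2_mean).  This is not obvious for y^2,
      whose own integral may be infinite.  But if y^2 is continued beyond M by
      its tangent line, the resulting function has an integral, and its drift is
      dominated by a multiple of 1 + y, uniformly in M, so that M can tend to
      infinity.  The outcome is a pair of linear equations for the mean of pi and
      the mean of s (affine_balance).  For theta < -1 they determine the mean
      (balance_solution); for theta = -1 the mean drops out of the second one,
      which then fails (critical_balance).

    - If -1 < theta < 0 and the mean of pi were finite, consider the larger of
      y^2 and N^2.  For N large its drift is nonnegative everywhere and positive
      at y >= N.  It also integrates to 0, since the function differs from y^2 by
      a bounded one.  So pi vanishes beyond N (bounded_support), although every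
      state has a transition to a higher one (one_step_up,
      unbounded_support). *)

(** * Real-valued integration against a probability *)

Notation L1 mu f := (mu.-integrable setT (EFin \o f)).

Section Expectation.
Context {d : measure_display} {T : measurableType d} {R : realType}.
Variable mu : probability T R.
Implicit Types f g : T -> R.

Lemma L1_cst (a : R) : L1 mu (fun=> a).
Proof. exact: (finite_measure_integrable_cst mu a measurableT). Qed.

Lemma L1D f g : L1 mu f -> L1 mu g -> L1 mu (fun x => f x + g x).
Proof. by move=> f1 g1; exact: (integrableD measurableT f1 g1). Qed.

Lemma L1Z (a : R) f : L1 mu f -> L1 mu (fun x => a * f x).
Proof. by move=> f1; exact: (integrableZl measurableT a f1). Qed.

Lemma L1B f g : L1 mu f -> L1 mu g -> L1 mu (fun x => f x - g x).
Proof. by move=> f1 g1; exact: (integrableB measurableT f1 g1). Qed.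

Lemma L1_dominated f g : measurable_fun setT f -> (forall x, `|f x| <= g x) ->
  L1 mu g -> L1 mu f.
Proof.
move=> mf fg; apply: le_integrable => //; first exact/measurable_EFinP.
move=> x _ /=; rewrite lee_fin; apply: le_trans (fg x) _; exact: ler_norm.
Qed.

Lemma L1_ge0 f : measurable_fun setT f -> (forall x, 0 <= f x) ->
  (\int[mu]_x (f x)%:E < +oo)%E -> L1 mu f.
Proof.
move=> mf f0 foo; apply/integrableP; split; first exact/measurable_EFinP.
by under eq_integral do rewrite /= ger0_norm ?f0//.
Qed.

Lemma ExpE f : L1 mu f -> (\int[mu]_x (f x)%:E)%E = (\int[mu]_x f x)%:E.
Proof. by move=> f1; rewrite /Rintegral fineK//; exact: integrable_fin_num. Qed.

Lemma Exp_cst (a : R) : \int[mu]_x a = a.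
Proof. by rewrite Rintegral_cst//= probability_setT mulr1. Qed.

Lemma ExpD f g : L1 mu f -> L1 mu g ->
  \int[mu]_x (f x + g x) = \int[mu]_x f x + \int[mu]_x g x.
Proof. exact: RintegralD. Qed.

Lemma ExpB f g : L1 mu f -> L1 mu g ->
  \int[mu]_x (f x - g x) = \int[mu]_x f x - \int[mu]_x g x.
Proof. exact: RintegralB. Qed.

Lemma ExpZ (a : R) f : L1 mu f ->
  \int[mu]_x (a * f x) = a * \int[mu]_x f x.
Proof. exact: RintegralZl. Qed.

Lemma le_Exp f g : L1 mu f -> L1 mu g -> (forall x, f x <= g x) ->
  \int[mu]_x f x <= \int[mu]_x g x.
Proof. by move=> f1 g1 fg; apply: le_Rintegral. Qed.

Lemma Exp_ge0 f : (forall x, 0 <= f x) -> 0 <= \int[mu]_x f x.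
Proof. by move=> f0; apply: Rintegral_ge0. Qed.

Lemma Exp_unique f (a : R) : (\int[mu]_x (f x)%:E)%E = a%:E -> \int[mu]_x f x = a.
Proof. by rewrite /Rintegral => ->. Qed.

(** Dominated convergence for real-valued functions. *)
Lemma cvg_Exp (f_ : nat -> T -> R) (f g : T -> R) :
  (forall n, measurable_fun setT (f_ n)) -> measurable_fun setT f ->
  (forall x, f_ n x @[n --> \oo] --> f x) ->
  (forall n x, `|f_ n x| <= g x) -> L1 mu g ->
  L1 mu f /\ (\int[mu]_x (f_ n x) @[n --> \oo] --> \int[mu]_x f x).
Proof.
move=> mf_ mf ff fg g1.
have c1 : {ae mu, forall x, setT x ->
    (EFin \o f_ n) x @[n --> \oo] --> (EFin \o f) x}.
  by apply: aeW => x _; apply: cvg_EFin; [exact: nearW|exact: ff].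
have c2 : {ae mu, forall x n, setT x -> (`|(EFin \o f_ n) x| <= (EFin \o g) x)%E}.
  by apply: aeW => x n _; rewrite /= lee_fin.
have [f1 _ cf] := dominated_convergence measurableT
  (fun n => (measurable_EFinP _ _).2 (mf_ n)) ((measurable_EFinP _ _).2 mf)
  c1 g1 c2.
split=> //; apply: fine_cvg; move: cf; rewrite (ExpE f1); exact.
Qed.

End Expectation.

(** * Variables with values in nat *)

Section NatValued.
Context {d : measure_display} {T : measurableType d} {R : realType}.
Variable P : probability T R.

Lemma measurable_nat_fun (U : T -> nat) :
  (forall a, measurable (U @^-1` [set a])) -> measurable_fun setT U.
Proof.
move=> mU _ A _; rewrite setTI.
have -> : U @^-1` A = \bigcup_(a in A) (U @^-1` [set a]).
  apply/seteqP; split=> [w Aw|w [a Aa /= ->//]]; by exists (U w).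
exact: bigcup_measurable.
Qed.

Lemma measurable_fibre (U : T -> nat) (A : set nat) :
  measurable_fun setT U -> measurable (U @^-1` A).
Proof. by move=> mU; rewrite -[X in measurable X]setTI; exact: mU. Qed.

(** A random choice U among countably many measurable functions is measurable;
    sums with a random number of terms are of this form. *)
Lemma measurable_bind (U : T -> nat) (F : nat -> T -> nat) :
  measurable_fun setT U -> (forall a, measurable_fun setT (F a)) ->
  measurable_fun setT (fun w => F (U w) w).
Proof.
move=> mU mF; apply: measurable_nat_fun => b.
have -> : (fun w => F (U w) w) @^-1` [set b] =
    \bigcup_a ((U @^-1` [set a]) `&` (F a @^-1` [set b])).
  apply/seteqP; split=> [w /= Fw|w [a _ [/= -> //]]]; by exists (U w).
by apply: bigcup_measurable => a _; apply: measurableI; exact: measurable_fibre.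
Qed.

Lemma measurable_binop (h : nat -> nat -> nat) (U W : T -> nat) :
  measurable_fun setT U -> measurable_fun setT W ->
  measurable_fun setT (fun w => h (U w) (W w)).
Proof.
move=> mU mW; apply: (@measurable_bind U (fun a w => h a (W w))) => // a.
exact: (@measurableT_comp _ _ _ _ _ _ (h a)).
Qed.

Lemma measurable_of_nat (f : nat -> R) (U : T -> nat) :
  measurable_fun setT U -> measurable_fun setT (fun w => f (U w)).
Proof. by move=> mU; exact: (@measurableT_comp _ _ _ _ _ _ f). Qed.

Lemma integral_fibres (D : set T) (f : T -> \bar R) (U : T -> nat) :
  measurable D -> measurable_fun setT U -> measurable_fun setT f ->
  (forall w, 0 <= f w)%E ->
  (\int[P]_(w in D) f w =
     \sum_(0 <= a <oo) \int[P]_(w in D `&` U @^-1` [set a]) f w)%E.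
Proof.
move=> mD mU mf f0.
have DE : D = \bigcup_a (D `&` U @^-1` [set a]).
  apply/seteqP; split=> [w Dw|w [a _ []//]]; by exists (U w).
rewrite [in LHS]DE ge0_integral_bigcup//.
- by move=> a; apply: measurableI => //; exact: measurable_fibre.
- rewrite -DE; exact: measurable_funTS.
- by move=> a b _ _ [w [[_ /= <-] [_ /= <-]]].
Qed.

Lemma integral_law (f : nat -> R) (U : T -> nat) :
  measurable_fun setT U -> (forall a, 0 <= f a) ->
  (\int[P]_w (f (U w))%:E =
     \sum_(0 <= a <oo) (f a)%:E * P (U @^-1` [set a]))%E.
Proof.
move=> mU f0.
rewrite (@integral_fibres setT _ U)//; last 2 first.
- by apply/measurable_EFinP; exact: measurable_of_nat.
- by move=> w; rewrite lee_fin.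
apply: eq_eseriesr => a _; rewrite setTI.
rewrite (eq_integral (cst (f a)%:E)); last by move=> w; rewrite inE/= => ->.
by rewrite integral_cst//; exact: measurable_fibre.
Qed.

Lemma integral_eq_law (f : nat -> R) (U W : T -> nat) :
  measurable_fun setT U -> measurable_fun setT W -> (forall a, 0 <= f a) ->
  (forall a, P (U @^-1` [set a]) = P (W @^-1` [set a])) ->
  (\int[P]_w (f (U w))%:E = \int[P]_w (f (W w))%:E)%E.
Proof.
move=> mU mW f0 UW; rewrite !integral_law//.
by apply: eq_eseriesr => a _; rewrite UW.
Qed.

(** Splitting along the values of U and W reduces the product rule for
    expectations to the one for point events.  The event B is there so that
    the rule can be applied conditionally on other variables. *)
Lemma integral_indep (B : set T) (U W : T -> nat) (f g : nat -> R) (a b : R) :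
  measurable B -> measurable_fun setT U -> measurable_fun setT W ->
  (forall k, 0 <= f k) -> (forall k, 0 <= g k) ->
  (forall i j, P (B `&` U @^-1` [set i] `&` W @^-1` [set j]) =
     P B * (P (U @^-1` [set i]) * P (W @^-1` [set j])))%E ->
  (\int[P]_w (f (U w))%:E = a%:E)%E -> (\int[P]_w (g (W w))%:E = b%:E)%E ->
  (\int[P]_(w in B) (f (U w) * g (W w))%:E = P B * (a * b)%:E)%E.
Proof.
move=> mB mU mW f0 g0 ind fa gb.
have mfg : measurable_fun setT (fun w => (f (U w) * g (W w))%:E).
  by apply/measurable_EFinP; apply: measurable_funM; exact: measurable_of_nat.
have fg0 w : (0 <= (f (U w) * g (W w))%:E)%E by rewrite lee_fin mulr_ge0.
have PBE : P B = (fine (P B))%:E by rewrite fineK// fin_num_measure.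
have prE (V : T -> nat) i : measurable_fun setT V ->
    P (V @^-1` [set i]) = (fine (P (V @^-1` [set i])))%:E.
  by move=> mV; rewrite fineK// fin_num_measure//; exact: measurable_fibre.
rewrite (@integral_fibres B _ U)//.
transitivity (\sum_(0 <= i <oo) ((fine (P B) * b)%:E *
    ((f i)%:E * P (U @^-1` [set i]))))%E; last first.
  rewrite nneseriesZl; last by move=> i _; rewrite mule_ge0 ?lee_fin.
  by rewrite -integral_law// fa [in RHS]PBE -!EFinM; congr EFin; ring.
apply: eq_eseriesr => i _.
have mBi : measurable (B `&` U @^-1` [set i]).
  by apply: measurableI => //; exact: measurable_fibre.
rewrite (@integral_fibres _ _ W)//.
transitivity (\sum_(0 <= j <oo)
    ((f i * fine (P B) * fine (P (U @^-1` [set i])))%:E *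
     ((g j)%:E * P (W @^-1` [set j]))))%E; last first.
  rewrite nneseriesZl; last by move=> j _; rewrite mule_ge0 ?lee_fin.
  by rewrite -integral_law// gb (prE U i mU) -!EFinM; congr EFin; ring.
apply: eq_eseriesr => j _.
rewrite (eq_integral (cst (f i * g j)%:E)); last first.
  by move=> w; rewrite inE/= => -[[_ ->] ->].
rewrite integral_cst//; last by apply: measurableI => //; exact: measurable_fibre.
transitivity ((f i * g j)%:E *
    (P B * (P (U @^-1` [set i]) * P (W @^-1` [set j]))))%E.
  by congr (_ * _)%E; exact: ind.
rewrite (prE U i mU) (prE W j mW) PBE -!EFinM; congr EFin.
by rewrite /=; ring.
Qed.

End NatValued.

Section Independence.
Context {d : measure_display} {T : measurableType d} {R : realType}.
Variable P : probability T R.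

Lemma mutually_independent_seq (idx : choiceType) (U : idx -> {RV P >-> nat})
    (s : seq (idx * set nat)) :
  mutually_independent U -> uniq [seq x.1 | x <- s] ->
  P (\big[setI/setT]_(x <- s) (U x.1 @^-1` x.2)) =
  (\prod_(x <- s) P (U x.1 @^-1` x.2))%E.
Proof.
move=> ind us.
(* The family of events must be total: setT away from the indices of s. *)
pose A j := foldr (fun x acc => if x.1 == j then x.2 else acc) setT s.
have AE x : x \in s -> A x.1 = x.2.
  rewrite /A; elim: s us {A} => // y s IH /= /andP[ys us].
  rewrite inE => /orP[/eqP ->|xs]; first by rewrite eqxx.
  case: eqP => [yx|_]; last exact: IH.
  by rewrite yx map_f in ys.
have pS : perm_eq [fset x in [seq x.1 | x <- s]]%fset [seq x.1 | x <- s].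
  by apply: uniq_perm => // x; rewrite inE.
have := ind [fset x in [seq x.1 | x <- s]]%fset A.
rewrite bigcap_fset !(perm_big _ pS)/= !big_map.
rewrite (eq_big_seq (fun x => U x.1 @^-1` x.2)); last by move=> x /AE ->.
by move=> ->; apply: eq_big_seq => x /AE ->.
Qed.

Lemma independent_pair (idx : choiceType) (U : idx -> {RV P >-> nat})
    (i j : idx) (A B : set nat) :
  mutually_independent U -> i != j ->
  P (U i @^-1` A `&` U j @^-1` B) = (P (U i @^-1` A) * P (U j @^-1` B))%E.
Proof.
move=> ind ij.
have := @mutually_independent_seq _ U [:: (i, A); (j, B)] ind.
rewrite !big_cons !big_nil/= setIT mule1; apply.
by rewrite inE ij.
Qed.

Lemma independent_quadruple (idx : choiceType) (U : idx -> {RV P >-> nat})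
    (i j k l : idx) (A B C D : set nat) :
  mutually_independent U -> uniq [:: i; j; k; l] ->
  P (U i @^-1` A `&` U j @^-1` B `&` U k @^-1` C `&` U l @^-1` D) =
  (P (U i @^-1` A `&` U j @^-1` B) * (P (U k @^-1` C) * P (U l @^-1` D)))%E.
Proof.
move=> ind u.
have ij : i != j by move: u => /=; rewrite !inE !negb_or => /andP[/andP[]].
rewrite (@independent_pair _ U)//.
have := @mutually_independent_seq _ U [:: (i, A); (j, B); (k, C); (l, D)] ind u.
by rewrite !big_cons !big_nil/= setIT mule1 !setIA !muleA.
Qed.

End Independence.

Section Moments.
Context {d : measure_display} {T : measurableType d} {R : realType}.
Variable P : probability T R.

Lemma momentE (k : nat) (U : T -> nat) :
  moment P k U = (\int[P]_w ((U w)%:R ^+ k)%:E)%E.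
Proof. by rewrite /moment unlock. Qed.

(** Powers of a natural number increase with the exponent, except that the
    zeroth power of 0 is 1; hence the constant 1 in the dominating function. *)
Lemma L1_moment (a b : nat) (U : {RV P >-> nat}) : (a <= b)%N ->
  (moment P b U < +oo)%E -> L1 P (fun w => (U w)%:R ^+ a : R).
Proof.
move=> ab; rewrite momentE => Ub.
have mU : measurable_fun setT U by [].
have Lb : L1 P (fun w => (U w)%:R ^+ b : R).
  apply: L1_ge0 => //; first exact: (measurable_of_nat (fun n => n%:R ^+ b) mU).
apply: L1_dominated (L1D (L1_cst P 1) Lb).
  exact: (measurable_of_nat (fun n => n%:R ^+ a) mU).
move=> w; rewrite ger0_norm ?exprn_ge0//; case: (U w) => [|n].
  by rewrite (@le_trans _ _ 1)// ?lerDl ?exprn_ge0//; case: a {ab} => [|a]; rewrite ?expr0// expr0n.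
apply: (@le_trans _ _ (n.+1%:R ^+ b)); last by rewrite lerDr.
by rewrite ler_weXn2l// (ler_nat R 1).
Qed.

Lemma moment1E (U : T -> nat) : fine (moment P 1 U) = \int[P]_w (U w)%:R.
Proof. by rewrite momentE. Qed.

Lemma L1_of_sqr (U : T -> nat) : measurable_fun setT U ->
  L1 P (fun w => (U w)%:R ^+ 2 : R) -> L1 P (fun w => (U w)%:R : R).
Proof.
move=> mU U2; apply: L1_dominated (L1D (L1_cst P 1) U2).
  exact: (measurable_of_nat (fun n => n%:R) mU).
by move=> w; rewrite ger0_norm//; move: (U w)%:R => t; nra.
Qed.

Lemma varE (U : T -> nat) : measurable_fun setT U ->
  L1 P (fun w => (U w)%:R ^+ 2 : R) ->
  fine (var P U) = \int[P]_w (U w)%:R ^+ 2 - (\int[P]_w (U w)%:R) ^+ 2.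
Proof.
move=> mU U2; have U1 := L1_of_sqr mU U2.
rewrite /var /variance covarianceE; last 3 first.
- exact/Lfun1_integrable.
- exact/Lfun1_integrable.
- by apply/Lfun1_integrable; move: U2; congr (L1 P _); apply/funext => w.
rewrite unlock (ExpE U1).
rewrite (_ : (\int[P]_w _)%E = (\int[P]_w ((U w)%:R ^+ 2))%:E).
  by rewrite -EFinM.
by rewrite -(ExpE U2).
Qed.

Lemma Exp_eq_law (f : nat -> R) (U V : {RV P >-> nat}) : (forall n, 0 <= f n) ->
  same_law U V -> (\int[P]_w (f (U w))%:E = \int[P]_w (f (V w))%:E)%E.
Proof.
move=> f0 UV; apply: integral_eq_law => // a.
exact: UV.
Qed.

Lemma Exp_mul_indep (U V : {RV P >-> nat}) :
  (forall A B, P (U @^-1` A `&` V @^-1` B) = P (U @^-1` A) * P (V @^-1` B))%E ->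
  L1 P (fun w => (U w)%:R : R) -> L1 P (fun w => (V w)%:R : R) ->
  L1 P (fun w => (U w)%:R * (V w)%:R : R) /\
  \int[P]_w ((U w)%:R * (V w)%:R) =
     (\int[P]_w (U w)%:R) * (\int[P]_w (V w)%:R) :> R.
Proof.
move=> ind U1 V1.
have E := @integral_indep _ _ _ P setT U V (fun n => n%:R) (fun n => n%:R)
  _ _ measurableT _ _ _ _ _ (ExpE U1) (ExpE V1).
have {}E : (\int[P]_w ((U w)%:R * (V w)%:R : R)%:E =
    ((\int[P]_w (U w)%:R) * (\int[P]_w (V w)%:R))%:E)%E.
  rewrite E//; last by move=> i j; rewrite setTI ind probability_setT mul1e.
  by rewrite probability_setT mul1e.
split; last exact: Exp_unique.
apply: L1_ge0; last by rewrite E ltry.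
  by apply: measurable_funM; exact: (measurable_of_nat (fun n => n%:R)).
by move=> w; rewrite mulr_ge0.
Qed.

Lemma var_sum3 (U V W : {RV P >-> nat}) :
  mutually_independent (fun i : 'I_3 => tnth [tuple U; V; W] i) ->
  L1 P (fun w => (U w)%:R ^+ 2 : R) -> L1 P (fun w => (V w)%:R ^+ 2 : R) ->
  L1 P (fun w => (W w)%:R ^+ 2 : R) ->
  fine (var P (fun w => (U w + V w + W w)%N)) =
  fine (var P U) + fine (var P V) + fine (var P W).
Proof.
move=> ind U2 V2 W2.
have mU : measurable_fun setT U by [].
have mV : measurable_fun setT V by [].
have mW : measurable_fun setT W by [].
have U1 := L1_of_sqr mU U2; have V1 := L1_of_sqr mV V2; have W1 := L1_of_sqr mW W2.
have ind2 (i j : 'I_3) : i != j -> forall A B, (P (tnth [tuple U; V; W] i @^-1` A `&`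
    tnth [tuple U; V; W] j @^-1` B) = P (tnth [tuple U; V; W] i @^-1` A) *
    P (tnth [tuple U; V; W] j @^-1` B))%E.
  move=> ij A' B'.
  exact: (@independent_pair _ _ _ _ _ (fun i => tnth [tuple U; V; W] i)).
have [UV1 UV] := @Exp_mul_indep U V (ind2 0 1 isT) U1 V1.
have [UW1 UW] := @Exp_mul_indep U W (ind2 0 (Ordinal (isT : 2 < 3)%N) isT) U1 W1.
have [VW1 VW] := @Exp_mul_indep V W (ind2 1 (Ordinal (isT : 2 < 3)%N) isT) V1 W1.
have sE w : ((U w + V w + W w)%N%:R ^+ 2 : R) =
   (U w)%:R ^+ 2 + ((V w)%:R ^+ 2 + ((W w)%:R ^+ 2 +
   (2 * ((U w)%:R * (V w)%:R) + (2 * ((U w)%:R * (W w)%:R) +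
    2 * ((V w)%:R * (W w)%:R))))).
  by rewrite !natrD; ring.
have s1 w : ((U w + V w + W w)%N%:R : R) = (U w)%:R + ((V w)%:R + (W w)%:R).
  by rewrite !natrD addrA.
have L1S : L1 P (fun w => ((U w + V w + W w)%N%:R ^+ 2 : R)).
  under eq_fun do rewrite sE.
  by repeat (apply: L1D => //; try exact: L1Z).
rewrite !varE//; last first.
  exact/(@measurable_binop _ _ addn)/mW/(@measurable_binop _ _ addn).
under eq_Rintegral do rewrite sE.
rewrite !ExpD; do ?[by repeat (apply: L1D => //; try exact: L1Z)|exact: L1Z| by []].
rewrite !ExpZ// UV UW VW.
under [X in _ - X ^+ 2]eq_Rintegral do rewrite s1.
rewrite !ExpD//; last exact: L1D.
ring.
Qed.

End Moments.

(** * Stationary chains on nat whose square has asymptotically linear drift *)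

Section LampertiChain.
Context {d : measure_display} {T : measurableType d} {R : realType}.
Variables (P : probability T R) (pi : probability nat R) (Z : nat -> T -> nat).
Hypothesis mZ : forall y, measurable_fun setT (Z y).
Hypothesis pi_stat : forall z, pi [set z] =
  (\sum_(0 <= y <oo) pi [set y] * P (Z y @^-1` [set z]))%E.

Lemma integral_pi (f : nat -> R) : (forall y, 0 <= f y) ->
  (\int[pi]_y (f y)%:E = \sum_(0 <= y <oo) (f y)%:E * pi [set y])%E.
Proof. by move=> f0; rewrite (@integral_law _ _ _ _ f id). Qed.

Lemma stationary_integral (V : nat -> R) : (forall y, 0 <= V y) ->
  (\int[pi]_y (V y)%:E =
   \sum_(0 <= y <oo) pi [set y] * \int[P]_w (V (Z y w))%:E)%E.
Proof.
move=> V0; rewrite integral_pi//.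
have PE y z : P (Z y @^-1` [set z]) = (fine (P (Z y @^-1` [set z])))%:E.
  by rewrite fineK// fin_num_measure//; exact: measurable_fibre.
have piE y : pi [set y] = (fine (pi [set y]))%:E by rewrite fineK// fin_num_measure.
transitivity (\sum_(0 <= z <oo) \sum_(0 <= y <oo)
    ((V z)%:E * (pi [set y] * P (Z y @^-1` [set z]))))%E.
  apply: eq_eseriesr => z _; rewrite pi_stat nneseriesZl//.
  by move=> y _; rewrite mule_ge0.
rewrite nneseries_interchange; last first.
  by move=> z y; rewrite !mule_ge0 ?lee_fin.
apply: eq_eseriesr => y _; rewrite (integral_law P (mZ y) V0).
rewrite [in RHS]piE -nneseriesZl; last by move=> z _; rewrite mule_ge0 ?lee_fin.
by apply: eq_eseriesr => z _; rewrite muleCA -piE.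
Qed.

(** The transition operator of the chain acting on functions. *)
Definition step (V : nat -> R) (y : nat) : R := \int[P]_w V (Z y w).

Lemma stationary_step (V : nat -> R) : (forall y, 0 <= V y) ->
  (forall y, L1 P (fun w => V (Z y w))) -> L1 pi V ->
  L1 pi (step V) /\ \int[pi]_y step V y = \int[pi]_y V y.
Proof.
move=> V0 VZ V1.
have s0 y : 0 <= step V y by exact: Exp_ge0.
have sE : (\int[pi]_y (step V y)%:E = \int[pi]_y (V y)%:E)%E.
  rewrite (stationary_integral V0) integral_pi//.
  by apply: eq_eseriesr => y _; rewrite muleC /step (ExpE (VZ y)).
split; last by rewrite /Rintegral sE.
apply: L1_ge0 => //.
by rewrite sE (ExpE V1) ltry.
Qed.

(** For a bounded function every integrability condition is automatic. *)
Lemma stationary_step_bounded (V : nat -> R) (c : R) :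
  (forall y, 0 <= V y <= c) -> L1 pi V /\
  [/\ forall y, L1 P (fun w => V (Z y w)), L1 pi (step V) &
     \int[pi]_y (step V y - V y) = 0].
Proof.
move=> Vc.
have V1 : L1 pi V.
  apply: L1_dominated (L1_cst pi c); first by [].
  by move=> y; have /andP[? ?] := Vc y; rewrite ger0_norm.
have VZ y : L1 P (fun w => V (Z y w)).
  apply: L1_dominated (L1_cst P c); first exact: measurable_of_nat.
  by move=> w; have /andP[? ?] := Vc (Z y w); rewrite ger0_norm.
have [|s1 sE] := stationary_step _ VZ V1; first by move=> y; have /andP[] := Vc y.
by split=> //; split=> //; rewrite ExpB// sE subrr.
Qed.

Local Notation "n %:r" := (n%:R : R) (at level 2, format "n %:r").

Hypothesis Z2 : forall y, L1 P (fun w => (Z y w)%:r ^+ 2).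

Lemma L1_Z y : L1 P (fun w => (Z y w)%:r).
Proof.
apply: L1_dominated (L1D (L1_cst P 1) (Z2 y)).
  exact: (measurable_of_nat (fun n => n%:r)).
move=> w; rewrite ger0_norm//.
by move: (Z y w)%:r => t; nra.
Qed.

Let drift (y : nat) : R := step (fun n => n%:r) y - y%:r.
Let drift2 (y : nat) : R := step (fun n => n%:r ^+ 2) y - y%:r ^+ 2.

Variables (A beta C : R).
Hypothesis drift_le : forall y, `|drift y| <= A.
Hypothesis drift2_le : forall y, `|drift2 y - beta * y%:r| <= C.

Let C_ge0 : 0 <= C. Proof. exact: le_trans (drift2_le 0). Qed.
Let A_ge0 : 0 <= A. Proof. exact: le_trans (drift_le 0). Qed.

(** Foster's criterion, with the square as Lyapunov function.  The square itself
    may fail to have an integral, so it is cut off at a level B.  By concavity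
    of the cut-off, its expected value after a step from y is at most the
    cut-off of y^2 + beta y + C.  So its expected increment is at most C
    everywhere, and at most beta y + C at the states below L if B is large. *)
Lemma mean_finite : beta < 0 -> L1 pi (fun y => y%:r).
Proof.
move=> beta0.
have key (L : nat) : \int[pi]_y (if (y < L)%N then - beta * y%:r else 0) <= C.
  pose B : R := L%:r ^+ 2 + C.
  have B0 : 0 <= B by rewrite addr_ge0// sqr_ge0.
  pose u (y : nat) : R := Num.min (y%:r ^+ 2) B.
  have uB y : 0 <= u y <= B.
    by rewrite le_min sqr_ge0 B0/= ge_min lexx orbT.
  have [u1 [uZ su1 su0]] := stationary_step_bounded uB.
  have su y : step u y <= Num.min (y%:r ^+ 2 + beta * y%:r + C) B.
    rewrite le_min; apply/andP; split; last first.
      rewrite -[leRHS](Exp_cst P); apply: le_Exp => //; first exact: L1_cst.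
      by move=> w; have /andP[] := uB (Z y w).
    apply: (@le_trans _ _ (step (fun n => n%:r ^+ 2) y)).
      by apply: le_Exp => // w; rewrite ge_min lexx.
    move: (drift2_le y); rewrite /drift2 ler_norml => /andP[_].
    by lra.
  have ind1 : L1 pi (fun y => if (y < L)%N then - beta * y%:r else 0).
    apply: L1_dominated (L1_cst pi (- beta * L%:r)).
      by [].
    move=> y; case: ltnP => yL; last by rewrite normr0 mulr_ge0 ?oppr_ge0 ?(ltW beta0).
    rewrite ger0_norm ?mulr_ge0 ?oppr_ge0 ?(ltW beta0)//.
    by rewrite ler_wpM2l ?oppr_ge0 ?(ltW beta0)// ler_nat ltnW.
  (* Stationarity: the expected increments of u average to 0. *)
  have -> : C = \int[pi]_y (C - (step u y - u y)).
    by rewrite ExpB; [rewrite Exp_cst su0 subr0|exact: L1_cst|exact: L1B].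
  apply: le_Exp => //; first by apply: L1B; [exact: L1_cst|exact: L1B].
  move=> y; have := su y; have C0 := C_ge0.
  have y0 : 0 <= y%:r by [].
  have by0 : beta * y%:r <= 0 by rewrite mulr_le0_ge0// ltW.
  case: ltnP => yL.
    have yL2 : y%:r ^+ 2 <= L%:r ^+ 2.
      by rewrite ler_sqr ?nnegrE// ler_nat ltnW.
    have -> : u y = y%:r ^+ 2 by apply/min_idPl; rewrite /B; have := C_ge0; lra.
    by rewrite le_min => /andP[]; lra.
  rewrite le_min => /andP[h1 h2].
  have : step u y - C <= u y by rewrite /u le_min; apply/andP; split; lra.
  by lra.
have b1 : L1 pi (fun y => - beta * y%:r).
  have b0 y : 0 <= - beta * y%:r by rewrite mulr_ge0// oppr_ge0 ltW.
  apply: L1_ge0 => //; rewrite integral_pi//.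
  apply: (@le_lt_trans _ _ C%:E); last exact: ltry.
  apply: lime_le.
    by apply: is_cvg_nneseries => n _ _; rewrite mule_ge0 ?lee_fin.
  near=> L; set f := fun y : nat => if (y < L)%N then - beta * y%:r else 0.
  have f0 y : 0 <= f y by rewrite /f; case: ifP.
  apply: (@le_trans _ _ (\int[pi]_y (f y)%:E)%E); last first.
    rewrite ExpE ?lee_fin; first exact: key.
    apply: L1_dominated (L1_cst pi (- beta * L%:r)) => // y.
    rewrite ger0_norm// /f; case: ltnP => // yL.
    by rewrite ler_wpM2l ?oppr_ge0 ?(ltW beta0)// ler_nat ltnW.
  rewrite integral_pi//.
  apply: le_trans (nneseries_lim_ge L _); last first.
    by move=> n _; rewrite mule_ge0 ?lee_fin.
  rewrite big_nat_cond [leRHS]big_nat_cond; apply: lee_sum => n /andP[/andP[_ nL] _].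
  by rewrite /f nL.
have := L1Z (- beta)^-1 b1; congr (L1 pi _); apply/funext => y.
by rewrite mulrA mulVf ?mul1r// oppr_eq0 lt_eqF.
Unshelve. all: by end_near.
Qed.

Hypothesis mean1 : L1 pi (fun y => y%:r).

Lemma drift_mean : L1 pi drift /\ \int[pi]_y drift y = 0.
Proof.
have [//|s1 sE] := stationary_step _ L1_Z mean1.
by split; [exact: L1B|rewrite /drift ExpB// sE subrr].
Qed.

Let trunc (M n : nat) : nat := minn n M.

(** The square up to M, continued by its tangent line at M (Huber's function). *)
Let huber (M n : nat) : R := (trunc M n)%:r * (2 * n%:r - (trunc M n)%:r).

Let huber_ge0 M n : 0 <= huber M n.
Proof.
have : (trunc M n)%:r <= n%:r by rewrite ler_nat geq_minl.
have : 0 <= (trunc M n)%:r by [].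
by rewrite /huber; nra.
Qed.

Let huber_le_sqr M n : huber M n <= n%:r ^+ 2.
Proof.
rewrite -subr_ge0; suff -> : n%:r ^+ 2 - huber M n = (n%:r - (trunc M n)%:r) ^+ 2.
  exact: sqr_ge0.
by rewrite /huber; ring.
Qed.

Let huber_le_lin M n : huber M n <= (2 * M%:r) * n%:r.
Proof.
have tM : (trunc M n)%:r <= M%:r by rewrite ler_nat geq_minr.
have t0 : 0 <= (trunc M n)%:r by [].
have n0 : 0 <= n%:r by [].
rewrite /huber; move: {tM t0 n0}(trunc M n)%:r M%:r n%:r tM t0 n0 => t m x *; nra.
Qed.

Let huber_ge_tangent M n t :
  huber M n + 2 * (trunc M n)%:r * (t%:r - n%:r) <= huber M t.
Proof.
rewrite /huber /trunc; rewrite /minn.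
have le (a b : nat) : (a <= b)%N -> a%:r <= b%:r by rewrite ler_nat.
have [/ltnW/le h1|/le h1] := ltnP n M; have [/ltnW/le h2|/le h2] := ltnP t M.
all: move: n%:r t%:r M%:r h1 h2 => x y m h1 h2.
- by have := sqr_ge0 (x - y); nra.
- have : 0 <= (m - x) * (y - m) by rewrite mulr_ge0// subr_ge0.
  by have := sqr_ge0 (m - x); nra.
- by have := sqr_ge0 (m - y); nra.
- by lra.
Qed.

Let huber_le_tangent M n t :
  huber M t <= huber M n + 2 * (trunc M n)%:r * (t%:r - n%:r) + (t%:r - n%:r) ^+ 2.
Proof.
rewrite /huber /trunc; rewrite /minn.
have le (a b : nat) : (a <= b)%N -> a%:r <= b%:r by rewrite ler_nat.
have [/ltnW/le h1|/le h1] := ltnP n M; have [/ltnW/le h2|/le h2] := ltnP t M.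
all: move: n%:r t%:r M%:r h1 h2 => x y m h1 h2.
- by lra.
- by have := sqr_ge0 (m - y); nra.
- have : 0 <= (m - y) * (x - m) by rewrite mulr_ge0// subr_ge0.
  by have := sqr_ge0 (x - m); nra.
- by have := sqr_ge0 (x - y); nra.
Qed.

Let huber_eq M n : (n <= M)%N -> huber M n = n%:r ^+ 2.
Proof. by move=> nM; rewrite /huber /trunc (minn_idPl nM); ring. Qed.

(** Stationarity makes the drift of each Huber function integrate to 0.  These
    functions are convex with second derivative at most 2, so their values
    lie between the tangent at y and the tangent plus the square of the
    increment.  Their drifts are therefore at most of linear order in y,
    uniformly in M, and the finite mean allows a passage to the limit. *)
Lemma drift2_mean : L1 pi drift2 /\ \int[pi]_y drift2 y = 0.
Proof.
have vZ M y : L1 P (fun w => huber M (Z y w)).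
  apply: L1_dominated (Z2 y); first exact: measurable_of_nat.
  by move=> w; rewrite ger0_norm.
have v1 M : L1 pi (huber M).
  apply: L1_dominated (L1Z (2 * M%:r) mean1) => // y.
  by rewrite ger0_norm.
pose f M y := step (huber M) y - huber M y.
have f0 M : \int[pi]_y f M y = 0.
  have [//|s1 sE] := stationary_step _ (vZ M) (v1 M).
  by rewrite /f ExpB// sE subrr.
have lin (c e k : R) y : L1 P (fun w => c + e * ((Z y w)%:r - k)).
  apply: L1D; first exact: L1_cst.
  by apply/L1Z/L1B; [exact: L1_Z|exact: L1_cst].
have linE (c e k : R) y : \int[P]_w (c + e * ((Z y w)%:r - k)) =
    c + e * (step (fun n => n%:r) y - k).
  rewrite ExpD ?Exp_cst; [|exact: L1_cst|]; last first.
    by apply/L1Z/L1B; [exact: L1_Z|exact: L1_cst].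
  congr (_ + _); rewrite ExpZ; last by apply: L1B; [exact: L1_Z|exact: L1_cst].
  by rewrite ExpB ?Exp_cst//; [exact: L1_Z|exact: L1_cst].
have mtr M y : 0 <= (trunc M y)%:r <= y%:r.
  by rewrite ler_nat geq_minl ler0n.
have f_ge M y : - (2 * A * y%:r) <= f M y.
  have : huber M y + 2 * (trunc M y)%:r * drift y <= step (huber M) y.
    by rewrite -linE; apply: le_Exp => // w; exact: huber_ge_tangent.
  have /andP[t0 ty] := mtr M y.
  have := drift_le y; rewrite ler_norml => /andP[dA _].
  rewrite /f.
  have : (trunc M y)%:r * (A + drift y) >= 0 by rewrite mulr_ge0//; lra.
  have : (y%:r - (trunc M y)%:r) * A >= 0 by rewrite mulr_ge0// subr_ge0.
  by nra.
have f_le M y : f M y <= (4 * A + `|beta|) * y%:r + C.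
  have h : step (huber M) y <= huber M y + 2 * (trunc M y)%:r * drift y +
      (drift2 y - 2 * y%:r * drift y).
    (* q is the square of the increment, Z - y squared. *)
    pose q w : R := (Z y w)%:r ^+ 2 +
       (- y%:r ^+ 2 + (- 2 * y%:r) * ((Z y w)%:r - y%:r)).
    have q1 : L1 P q by apply: L1D.
    apply: (@le_trans _ _ (\int[P]_w ((huber M y + 2 * (trunc M y)%:r *
       ((Z y w)%:r - y%:r)) + q w))).
      apply: le_Exp => //; first exact: L1D.
      move=> w; apply: le_trans (huber_le_tangent M y (Z y w)) _.
      by rewrite /q; lra.
    rewrite ExpD// linE /q ExpD// linE /drift2 /drift /step.
    by lra.
  have /andP[t0 ty] := mtr M y.
  have := drift_le y; rewrite ler_norml => /andP[dA dA'].
  have := drift2_le y; rewrite ler_norml => /andP[_ d2].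
  have y0 : 0 <= y%:r by [].
  have b0 : beta * y%:r <= `|beta| * y%:r by rewrite ler_wpM2r// ler_norm.
  rewrite /f.
  have : (trunc M y)%:r * (A - drift y) >= 0 by rewrite mulr_ge0//; lra.
  have : (y%:r - (trunc M y)%:r) * A >= 0 by rewrite mulr_ge0// subr_ge0.
  have : y%:r * (A + drift y) >= 0 by rewrite mulr_ge0//; lra.
  by nra.
have f_cvg y : f M y @[M --> \oo] --> drift2 y.
  apply: cvgB; last first.
    by apply: cvg_near_cst; exists y => // M /= yM; exact: huber_eq.
  have [|||||_] := @cvg_Exp _ _ _ P (fun M w => huber M (Z y w))
    (fun w => (Z y w)%:r ^+ 2) (fun w => (Z y w)%:r ^+ 2); last exact.
  - by move=> M; exact: measurable_of_nat.
  - exact: (measurable_of_nat (fun n => n%:r ^+ 2)).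
  - by move=> w; apply: cvg_near_cst; exists (Z y w) => // M /= yM; exact: huber_eq.
  - by move=> M w; rewrite ger0_norm.
  - exact: Z2.
have [|||||d1 cf] := @cvg_Exp _ _ _ pi f drift2
    (fun y => (4 * A + `|beta|) * y%:r + C).
- by [].
- by [].
- exact: f_cvg.
- move=> M y; rewrite ler_norml f_le andbT.
  apply: le_trans (f_ge M y); rewrite lerN2.
  have : 0 <= `|beta| * y%:r by rewrite mulr_ge0.
  have : 0 <= A * y%:r by rewrite mulr_ge0.
  by have := C_ge0; lra.
- by apply: L1D; [exact: L1Z|exact: L1_cst].
split=> //; apply: cvg_unique cf _ => //.
have -> : (fun n => \int[pi]_x f n x) = fun=> 0 by apply/funext; exact: f0.
exact: cvg_cst.
Qed.

(** The maximum of the squares of y and of N is the square of y plus a bounded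
    function, so its drift also integrates to 0.  Below N this drift is
    nonnegative, because the function is at its minimum there; from N on it is at
    least the drift of the square, which is positive.  Hence pi cannot charge
    the states from N on. *)
Lemma bounded_support : 0 < beta ->
  exists N, forall y, (N <= y)%N -> pi [set y] = 0%E.
Proof.
move=> beta0.
have [N CN] : exists N : nat, C < beta * N%:r.
  have [N hN] : exists N : nat, C / beta < N%:r.
    exists (Num.bound (C / beta)); apply: archi_boundP.
    by rewrite divr_ge0// ltW.
  by exists N; rewrite mulrC -ltr_pdivrMr.
exists N => y0 Ny0.
(* The bounded function to be added to the square. *)
pose V (n : nat) : R := Num.max (N%:r ^+ 2 - n%:r ^+ 2) 0.
have VN n : 0 <= V n <= N%:r ^+ 2.
  rewrite le_max lexx orbT/= ge_max sqr_ge0 andbT.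
  by rewrite lerBlDr lerDl sqr_ge0.
have [V1 [VZ sV1 sV0]] := stationary_step_bounded VN.
have [d1 d0] := drift2_mean.
pose h y := drift2 y + (step V y - V y).
have h1 : L1 pi h by apply: L1D => //; exact: L1B.
have hE : \int[pi]_y h y = 0 by rewrite /h ExpD ?d0 ?sV0 ?addr0//; exact: L1B.
have V_ge0 n : 0 <= V n by have /andP[] := VN n.
have h_big y : (N <= y)%N -> 0 < h y.
  move=> Ny; have : 0 <= step V y by exact: Exp_ge0.
  have -> : h y = drift2 y + step V y.
    rewrite /h; suff -> : V y = 0 by rewrite subr0.
    by apply/max_idPr; rewrite subr_le0 ler_sqr ?nnegrE// ler_nat.
  have : beta * N%:r <= beta * y%:r by rewrite ler_wpM2l ?ler_nat// ltW.
  have := drift2_le y; rewrite ler_norml => /andP[+ _].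
  by lra.
have h0 y : 0 <= h y.
  have [/h_big/ltW//|yN] := leqP N y.
  have -> : h y = (step (fun n => n%:r ^+ 2) y + step V y) - N%:r ^+ 2.
    rewrite /h /drift2; suff -> : V y = N%:r ^+ 2 - y%:r ^+ 2 by ring.
    by apply/max_idPl; rewrite subr_ge0 ler_sqr ?nnegrE// ler_nat ltnW.
  rewrite subr_ge0 /step -ExpD// -[leLHS](Exp_cst P).
  apply: le_Exp; [exact: L1_cst|exact: L1D|move=> w].
  by rewrite -lerBlDl le_max lexx.
have : (\int[pi]_(y in [set y0]) (h y)%:E <= 0)%E.
  rewrite -[leRHS]/(0%:E) -hE -ExpE//; apply: ge0_subset_integral => //.
  by move=> y _; rewrite lee_fin.
rewrite (eq_integral (cst (h y0)%:E)); last by move=> y; rewrite inE/= => ->.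
rewrite integral_cst// pmule_rle0 ?lte_fin; last exact: h_big.
by move=> pi0; apply/eqP; rewrite eq_le measure_ge0 andbT.
Qed.

(** A largest charged state would send mass to a higher state. *)
Lemma unbounded_support (N : nat) :
  (forall y, exists2 z, (y < z)%N & (0 < P (Z y @^-1` [set z]))%E) ->
  ~ (forall y, (N <= y)%N -> pi [set y] = 0%E).
Proof.
move=> up piN.
have [y0 y0P] : exists y, pi [set y] != 0%E.
  apply: contrapT => /forallNP pi0.
  have : (\int[pi]_y (1 : R)%:E = 0)%E.
    rewrite integral_pi// eseries0// => y _ _.
    by have /negP/negPn/eqP -> := pi0 y; rewrite mule0.
  move=> E0; have := Exp_cst pi (1 : R); rewrite /Rintegral E0/= => /eqP.
  by rewrite eq_sym oner_eq0.
have bd y : pi [set y] != 0%E -> (y <= N)%N.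
  by apply: contraNT; rewrite -ltnNge => /ltnW /piN ->.
have [y yP ymax] := ex_maxnP (ex_intro _ y0 y0P) bd.
have [z yz Pz] := up y.
have : (pi [set y] * P (Z y @^-1` [set z]) <= pi [set z])%E.
  rewrite [leRHS]pi_stat; apply: le_trans (nneseries_lim_ge y.+1 _).
    rewrite big_nat_recr//= leeDr//; apply: sume_ge0 => n _.
    by rewrite mule_ge0.
  by move=> n _; rewrite mule_ge0.
have -> : pi [set z] = 0%E.
  apply/eqP; apply: contraTT yz => /ymax; by rewrite -leqNgt.
by rewrite leNgt mule_gt0// lt0e yP measure_ge0.
Qed.

End LampertiChain.

(** The case at hand: up to a multiple of a function t with values in [0, 1],
    the drift of y is constant and the drift of its square is affine. *)
Section AffineDrift.
Context {d : measure_display} {T : measurableType d} {R : realType}.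
Variables (P : probability T R) (pi : probability nat R) (Z : nat -> T -> nat).
Hypothesis mZ : forall y, measurable_fun setT (Z y).
Hypothesis pi_stat : forall z, pi [set z] =
  (\sum_(0 <= y <oo) pi [set y] * P (Z y @^-1` [set z]))%E.
Hypothesis Z2 : forall y, L1 P (fun w => (Z y w)%:R ^+ 2 : R).
Variables (mu c beta C0 C1 : R) (t : nat -> R).
Hypothesis t01 : forall y, 0 <= t y <= 1.
Hypothesis Z_mean : forall y, \int[P]_w ((Z y w)%:R : R) = y%:R + mu - c * t y.
Hypothesis Z_sqr : forall y, \int[P]_w ((Z y w)%:R ^+ 2 : R) =
  y%:R ^+ 2 + beta * y%:R + (C0 + C1 * t y).

Let drift_le y : `|step P Z (fun n => n%:R) y - y%:R| <= `|mu| + `|c|.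
Proof.
rewrite /step Z_mean (_ : _ - _ = mu - c * t y); last by ring.
apply: le_trans (ler_normB _ _) _; rewrite lerD2l normrM.
by have /andP[t0 t1] := t01 y; rewrite (ger0_norm t0) ler_piMr.
Qed.

Let drift2_le y :
  `|step P Z (fun n => n%:R ^+ 2) y - y%:R ^+ 2 - beta * y%:R| <= `|C0| + `|C1|.
Proof.
rewrite /step Z_sqr (_ : _ - _ - _ = C0 + C1 * t y); last by ring.
apply: le_trans (ler_normD _ _) _; rewrite lerD2l normrM.
by have /andP[t0 t1] := t01 y; rewrite (ger0_norm t0) ler_piMr.
Qed.

Lemma affine_mean_finite : beta < 0 -> L1 pi (fun y => y%:R : R).
Proof. exact: (mean_finite mZ pi_stat Z2 drift2_le). Qed.

Lemma affine_mean_infinite : 0 < beta ->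
  (forall y, exists2 z, (y < z)%N & (0 < P (Z y @^-1` [set z]))%E) ->
  ~ L1 pi (fun y => y%:R : R).
Proof.
move=> beta0 up pi1.
have [N piN] := bounded_support mZ pi_stat Z2 drift_le drift2_le pi1 beta0.
exact: (unbounded_support pi_stat up piN).
Qed.

(** These are the statements that the drifts of y and of its square have
    integral 0. *)
Lemma affine_balance : L1 pi (fun y => y%:R : R) ->
  mu = c * \int[pi]_y t y /\
  beta * \int[pi]_y (y%:R : R) + (C0 + C1 * \int[pi]_y t y) = 0.
Proof.
move=> pi1.
have t_L1 : L1 pi t.
  apply: L1_dominated (L1_cst pi 1) => // y.
  by have /andP[t0 t1] := t01 y; rewrite ger0_norm.
split.
  have [_] := drift_mean mZ pi_stat Z2 pi1.
  rewrite (@eq_Rintegral _ _ _ pi setT (fun y => mu - c * t y)); last first.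
    by move=> y _; rewrite /step Z_mean; ring.
  rewrite ExpB; [|exact: L1_cst|exact: L1Z].
  by rewrite Exp_cst ExpZ// => /eqP; rewrite subr_eq0 => /eqP.
have [_] := drift2_mean mZ pi_stat Z2 drift_le drift2_le pi1.
rewrite (@eq_Rintegral _ _ _ pi setT (fun y => beta * y%:R + (C0 + C1 * t y)));
  last by move=> y _; rewrite /step Z_sqr; ring.
have h : L1 pi (fun y => C0 + C1 * t y).
  by apply: L1D; [exact: L1_cst|exact: L1Z].
rewrite ExpD//; last exact: L1Z.
rewrite ExpD; [|exact: L1_cst|exact: L1Z].
by rewrite Exp_cst !ExpZ.
Qed.

End AffineDrift.

(** * The geometric law *)

(** For the quadratic polynomial f with coefficients c0, c1, c2 and geometric K,
    this computes E (f (s - K); K < s).  By lack of memory it is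
    E f(s - K) - p^s E f(- K), which is the right-hand side; the induction on s
    needs only the finite sum. *)
Lemma geometric_convolution {R : realType} (p c0 c1 c2 : R) (s : nat) :
  p < 1 -> let rho := p / (1 - p) in
  \sum_(0 <= k < s) (1 - p) * p ^+ k *
      (c0 + c1 * (s - k)%:R + c2 * (s - k)%:R ^+ 2) =
  c0 * (1 - p ^+ s) + c1 * (s%:R - rho * (1 - p ^+ s)) +
  c2 * (s%:R ^+ 2 - 2 * rho * s%:R + (rho + 2 * rho ^+ 2) * (1 - p ^+ s)).
Proof.
move=> p1 rho; have q0 : 1 - p != 0 by rewrite subr_eq0 gt_eqF.
elim: s => [|s IH]; first by rewrite big_nil expr0 /rho; field.
rewrite big_nat_recl// expr0 subn0.
(* Either K = 0, or K - 1 is geometric and compared with s. *)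
transitivity ((1 - p) * (c0 + c1 * s.+1%:R + c2 * s.+1%:R ^+ 2) +
   p * (\sum_(0 <= k < s) (1 - p) * p ^+ k *
      (c0 + c1 * (s - k)%:R + c2 * (s - k)%:R ^+ 2))).
  rewrite mulr1; congr (_ + _); rewrite mulr_sumr; apply: eq_bigr => k _.
  by rewrite subSS exprS; ring.
rewrite IH [p ^+ s.+1]exprS -[s.+1%:R]natr1 /rho.
by move: (p ^+ s) (s%:R) => e x; field.
Qed.

Section Geometric.
Context {d : measure_display} {T : measurableType d} {R : realType}.
Variables (P : probability T R) (p : R) (K : T -> nat).
Hypotheses (p_gt0 : 0 < p) (p_lt1 : p < 1) (mK : measurable_fun setT K).
Hypothesis K_geo : forall k, P (K @^-1` [set k]) = ((1 - p) * p ^+ k)%:E.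

Let rho := p / (1 - p).

Let q_neq0 : 1 - p != 0. Proof. by rewrite subr_eq0 gt_eqF. Qed.
Let rho_ge0 : 0 <= rho. Proof. by rewrite divr_ge0 ?subr_ge0 ?ltW. Qed.

Let K_law (f : nat -> R) : (forall k, 0 <= f k) ->
  (\int[P]_w (f (K w))%:E = \sum_(0 <= k <oo) (f k * ((1 - p) * p ^+ k))%:E)%E.
Proof.
move=> f0; rewrite (integral_law P mK f0).
by apply: eq_eseriesr => k _; rewrite K_geo EFinM.
Qed.

Let term_ge0 (f : nat -> R) k : (forall k, 0 <= f k) ->
  (0 <= (f k * ((1 - p) * p ^+ k))%:E)%E.
Proof.
move=> f0; rewrite lee_fin mulr_ge0// mulr_ge0 ?subr_ge0 ?(ltW p_lt1)//.
by rewrite exprn_ge0// ltW.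
Qed.

(** A nonnegative solution g of this recursion makes the partial sums of E f(K)
    telescope below g 0.  The natural candidate is g k = E f(K + k). *)
Let L1_geometric (f g : nat -> R) : (forall k, 0 <= f k) -> (forall k, 0 <= g k) ->
  (forall k, g k - p * g k.+1 = (1 - p) * f k) -> L1 P (fun w => f (K w)).
Proof.
move=> f0 g0 fg; apply: L1_ge0 => //; first exact: measurable_of_nat.
have tel n : \sum_(0 <= k < n) (f k * ((1 - p) * p ^+ k)) = g 0 - p ^+ n * g n.
  elim: n => [|m IH]; first by rewrite big_nil expr0; ring.
  rewrite big_nat_recr//= IH exprS; have := fg m.
  move: (g m) (g m.+1) (p ^+ m) (f m) => a b e c h.
  have -> : c * ((1 - p) * e) = e * (a - p * b) by rewrite h; ring.
  by ring.
rewrite K_law//; apply: (@le_lt_trans _ _ (g 0)%:E); last exact: ltry.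
apply: lime_le; first by apply: is_cvg_nneseries => k _ _; exact: term_ge0.
near=> n; rewrite sumEFin lee_fin tel.
by rewrite gerBl mulr_ge0// exprn_ge0// ltW.
Unshelve. all: by end_near.
Qed.

(** Lack of memory: given K >= 1, the law of K is that of K + 1. *)
Let geometric_shift (f : nat -> R) : (forall k, 0 <= f k) ->
  L1 P (fun w => f (K w)) -> L1 P (fun w => f (K w).+1) ->
  \int[P]_w f (K w) = (1 - p) * f 0%N + p * \int[P]_w f (K w).+1.
Proof.
move=> f0 f1 f1S; apply: EFin_inj.
rewrite -(ExpE f1) K_law// (nneseries_split 0 1)//; last first.
  by move=> k _; exact: term_ge0.
rewrite add0n big_nat1 expr0 mulr1 EFinD [(p * _)%:E]EFinM -(ExpE f1S).
congr (_ + _)%E; first by rewrite mulrC.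
rewrite (@K_law (fun k => f k.+1))// -nneseriesZl; last first.
  by move=> k _; exact: (@term_ge0 (fun k => f k.+1)).
rewrite -nneseries_addn; last by move=> k; exact: term_ge0.
apply: eq_eseriesr => k _; rewrite -EFinM addn1 exprS; congr EFin.
by move: (f _) (p ^+ k) => a e; ring.
Qed.

Lemma geometric_mean :
  L1 P (fun w => (K w)%:R : R) /\ \int[P]_w ((K w)%:R : R) = rho.
Proof.
have g_id k : (k%:R + rho) - p * (k.+1%:R + rho) = (1 - p) * k%:R.
  by rewrite -[k.+1%:R]natr1 /rho; move: k%:R => x; field.
have K1 : L1 P (fun w => (K w)%:R : R).
  by apply: L1_geometric g_id => // k; rewrite addr_ge0.
split=> //.
have SE : (fun w => (K w).+1%:R : R) = (fun w => (K w)%:R + 1).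
  by apply/funext => w; rewrite natr1.
have K1S : L1 P (fun w => (K w).+1%:R : R).
  by rewrite SE; apply: L1D => //; exact: L1_cst.
have := geometric_shift (fun=> ler0n _ _) K1 K1S.
rewrite SE ExpD ?Exp_cst//; last exact: L1_cst.
rewrite mulr0 add0r => h; apply: (mulfI q_neq0).
rewrite /rho mulrCA mulfV// mulr1; lra.
Qed.

Lemma geometric_moment2 :
  L1 P (fun w => (K w)%:R ^+ 2 : R) /\
  \int[P]_w ((K w)%:R ^+ 2 : R) = rho + 2 * rho ^+ 2.
Proof.
have [K1 KE] := geometric_mean.
pose g k : R := k%:R ^+ 2 + 2 * rho * k%:R + (rho + 2 * rho ^+ 2).
have g_id k : g k - p * g k.+1 = (1 - p) * k%:R ^+ 2.
  by rewrite /g -[k.+1%:R]natr1 /rho; move: k%:R => x; field.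
have K2 : L1 P (fun w => (K w)%:R ^+ 2 : R).
  apply: (L1_geometric (f := fun k => k%:R ^+ 2)) g_id => k.
    exact: sqr_ge0.
  have r0 := rho_ge0; have k0 : 0 <= k%:R :> R by [].
  by rewrite /g; move: k%:R k0 => x x0; nra.
split=> //.
have SE : (fun w => (K w).+1%:R ^+ 2 : R) =
    (fun w => (K w)%:R ^+ 2 + (2 * (K w)%:R + 1)).
  by apply/funext => w; rewrite -natr1; ring.
have K3 : L1 P (fun w => 2 * (K w)%:R + 1 : R).
  by apply: L1D; [exact: L1Z|exact: L1_cst].
have K2S : L1 P (fun w => (K w).+1%:R ^+ 2 : R) by rewrite SE; exact: L1D.
have := geometric_shift (f := fun k => k%:R ^+ 2) (fun=> sqr_ge0 _) K2 K2S.
rewrite SE ExpD// ExpD ?Exp_cst ?ExpZ// ?KE; [|exact: L1Z|exact: L1_cst].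
rewrite expr0n/= mulr0 add0r => h; apply: (mulfI q_neq0).
suff -> : (1 - p) * (rho + 2 * rho ^+ 2) = p * (2 * rho + 1) by lra.
by rewrite /rho; field.
Qed.

End Geometric.


(** * Solving the balance equations *)

(** In the drift of the square of the population size, the constant term and the
    coefficient of the survival probability.  Here s2 is the offspring
    variance, and i2 and j2 are the second moments of I and J. *)
Definition sqr_drift_cst {R : pzRingType} (mu nu rho s2 i2 : R) : R :=
  (2 * nu + s2) * mu + i2 - 2 * rho * mu.

Definition sqr_drift_survival {R : pzRingType} (nu rho s2 j2 : R) : R :=
  j2 - (2 * nu + s2) * rho + (rho + 2 * rho ^+ 2).

Section Balance.
Context {R : realFieldType}.
Variables (mu nu rho s2 i2 j2 tau : R).
Hypotheses (mu_gt0 : 0 < mu) (nu_ge0 : 0 <= nu) (rho_gt0 : 0 < rho).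
Hypotheses (i2_ge0 : 0 <= i2) (j2_ge0 : 0 <= j2).
Hypotheses (a_lt0 : mu + nu - rho < 0) (tauE : mu = (rho - nu) * tau).

Let rn_gt0 : 0 < rho - nu. Proof. by move: a_lt0 mu_gt0; lra. Qed.

Let tau_eq : tau = mu / (rho - nu).
Proof. by rewrite tauE mulrC mulKf// gt_eqF. Qed.

(** At theta = -1 the mean has coefficient 0 in the second balance equation.
    After multiplication by rho - nu, what is left of it equals
    i2 (rho - nu) + mu (2 mu nu + j2 + rho), a positive number. *)
Lemma critical_balance : 2 * (mu + nu - rho) + s2 = 0 ->
  sqr_drift_cst mu nu rho s2 i2 + sqr_drift_survival nu rho s2 j2 * tau != 0.
Proof.
move=> crit; have s2E : s2 = 2 * (rho - nu - mu) by lra.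
rewrite gt_eqF// -(pmulr_rgt0 _ rn_gt0) tau_eq.
have -> : (rho - nu) * (sqr_drift_cst mu nu rho s2 i2 +
      sqr_drift_survival nu rho s2 j2 * (mu / (rho - nu))) =
    i2 * (rho - nu) + mu * (2 * mu * nu + j2 + rho).
  by rewrite /sqr_drift_cst /sqr_drift_survival s2E; field; rewrite gt_eqF.
by rewrite ltr_wpDl ?mulr_ge0 ?(ltW rn_gt0)// mulr_gt0// ltr_wpDl// addr_ge0// !mulr_ge0// ltW.
Qed.

Lemma balance_solution (theta m : R) :
  0 < s2 -> theta * s2 = 2 * (mu + nu - rho) -> theta < -1 ->
  (2 * (mu + nu - rho) + s2) * m +
    (sqr_drift_cst mu nu rho s2 i2 + sqr_drift_survival nu rho s2 j2 * tau) = 0 ->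
  m = - theta * mu / (4 * (theta + 1) * (nu - rho)) *
    (theta * s2 - 2 * mu + 4 * nu / theta + 2 * (i2 - mu ^+ 2) / mu -
     4 * ((i2 - mu ^+ 2) + (j2 - nu ^+ 2) + (rho + 2 * rho ^+ 2 - rho ^+ 2)) /
       (s2 * theta)).
Proof.
move=> s2_gt0 thetaE theta_lt bal.
have t0 : theta != 0 by rewrite lt_eqF//; lra.
have t1 : theta + 1 != 0 by rewrite lt_eqF//; lra.
have s0 : s2 != 0 by rewrite gt_eqF.
have b0 : 2 * (mu + nu - rho) + s2 != 0.
  by rewrite -thetaE (_ : _ + s2 = (theta + 1) * s2) ?mulf_neq0//; ring.
move/eqP: bal; rewrite addr_eq0 mulrC => /eqP bal.
rewrite -(mulfK b0 m) bal.
rewrite tau_eq /sqr_drift_cst /sqr_drift_survival.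
have mu0 : mu != 0 by rewrite gt_eqF.
have rn0 : rho - nu != 0 by rewrite gt_eqF.
have nr0 : nu - rho != 0 by rewrite -opprB oppr_eq0.
have s2E : s2 = 2 * (mu + nu - rho) / theta.
  by rewrite -thetaE mulrAC divff ?mul1r.
have a0 : mu + nu - rho != 0 by rewrite lt_eqF.
rewrite s2E; field.
rewrite t0 a0 mu0 nr0 t1 rn0 andbT/=.
by rewrite -[X in _ + X]mulr1 -mulrDr !mulf_neq0.
Qed.

End Balance.

(** * One step of the branching process *)

Section OneStep.
Context {d : measure_display} {T : measurableType d} {R : realType}.
Variables (P : probability T R) (p : R).
Variables (I J K : T -> nat) (X : nat -> T -> nat).
Hypotheses (p_gt0 : 0 < p) (p_lt1 : p < 1).
Hypotheses (mI : measurable_fun setT I) (mJ : measurable_fun setT J)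
  (mK : measurable_fun setT K) (mX : forall m, measurable_fun setT (X m)).

(** One family for all the terms of the random sum: None stands for J. *)
Definition summand (u : option nat) : T -> nat := if u is Some m then X m else J.

Let B (i k : nat) : set T := I @^-1` [set i] `&` K @^-1` [set k].

Hypothesis IK_law : forall i k,
  P (B i k) = (P (I @^-1` [set i]) * ((1 - p) * p ^+ k)%:E)%E.
Hypothesis IK_summands_indep : forall i k u v a b, u != v ->
  (P (B i k `&` summand u @^-1` [set a] `&` summand v @^-1` [set b]) =
   P (B i k) *
   (P (summand u @^-1` [set a]) * P (summand v @^-1` [set b])))%E.

Variables (nu j2 s2 : R).
Hypotheses (J_mean : (\int[P]_w ((J w)%:R%:E : \bar R) = nu%:E)%E)
  (J_sqr : (\int[P]_w (((J w)%:R ^+ 2)%:E : \bar R) = j2%:E)%E)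
  (X_mean : forall m, (\int[P]_w ((X m w)%:R%:E : \bar R) = 1%:E)%E)
  (X_sqr : forall m, (\int[P]_w (((X m w)%:R ^+ 2)%:E : \bar R) = (s2 + 1)%:E)%E).

Let pI (i : nat) : R := fine (P (I @^-1` [set i])).

Let mB i k : measurable (B i k).
Proof. by apply: measurableI; exact: measurable_fibre. Qed.

Let m_summand u : measurable_fun setT (summand u).
Proof. by case: u. Qed.

Let PB i k : P (B i k) = (pI i * ((1 - p) * p ^+ k))%:E.
Proof.
by rewrite IK_law [RHS]EFinM /pI fineK// fin_num_measure//; exact: measurable_fibre.
Qed.

Let m1 (u : option nat) : R := if u is Some _ then 1 else nu.
Let m2 (u : option nat) : R := if u is Some _ then s2 + 1 else j2.

Let summand_mean u : (\int[P]_w ((summand u w)%:R%:E : \bar R) = (m1 u)%:E)%E.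
Proof. by case: u. Qed.

Let summand_sqr u :
  (\int[P]_w (((summand u w)%:R ^+ 2)%:E : \bar R) = (m2 u)%:E)%E.
Proof. by case: u. Qed.

Let int_one : (\int[P]_w (1%R%:E : \bar R) = 1%:E)%E.
Proof. by rewrite (ExpE (L1_cst P 1)) Exp_cst. Qed.

(* The product rule below needs two distinct summands, even for a function of
   only one of them. *)
Let other (u : option nat) : option nat := if u is Some _ then None else Some 0%N.

Let other_neq u : u != other u. Proof. by case: u. Qed.

Let cond_mul i k u v : u != v ->
  (\int[P]_(w in B i k) ((summand u w)%:R * (summand v w)%:R)%:E =
   P (B i k) * (m1 u * m1 v)%:E)%E.
Proof.
move=> uv; apply: (@integral_indep _ _ _ P (B i k) (summand u) (summand v)
  (fun n => n%:R) (fun n => n%:R)) => // a b; exact: IK_summands_indep.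
Qed.

Let cond_fun i k u (f : nat -> R) (a : R) : (forall n, 0 <= f n) ->
  (\int[P]_w (f (summand u w))%:E = a%:E)%E ->
  (\int[P]_(w in B i k) (f (summand u w))%:E = P (B i k) * a%:E)%E.
Proof.
move=> f0 fa; rewrite -[a]mulr1.
rewrite -(@integral_indep _ _ _ P (B i k) (summand u) (summand (other u))
  f (fun=> 1))//.
- by apply: eq_integral => w _; rewrite mulr1.
- by move=> a' b'; exact: IK_summands_indep.
Qed.

Definition births (n : nat) (w : T) : nat := (J w + \sum_(m < n) X m w)%N.

Let birthsS n w : births n.+1 w = (births n w + X n w)%N.
Proof. by rewrite /births big_ord_recr/= addnA. Qed.

Let births0 w : births 0 w = J w. Proof. by rewrite /births big_ord0 addn0. Qed.

Let m_births n : measurable_fun setT (births n).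
Proof.
elim: n => [|n IH].
  by rewrite (_ : births 0 = J)//; apply/funext => w; exact: births0.
rewrite (_ : births n.+1 = fun w => births n w + X n w)%N; first exact: measurable_binop.
by apply/funext => w; exact: birthsS.
Qed.

Let mEr (f : T -> R) D : measurable_fun setT f -> measurable_fun D (EFin \o f).
Proof. by move=> mf; apply: measurable_funTS; exact/measurable_EFinP. Qed.

Let mnat (f : nat -> R) (U : T -> nat) :=
  @measurable_of_nat _ T R f U.

Let cond_births i k n :
  (\int[P]_(w in B i k) (births n w)%:R%:E = P (B i k) * (nu + n%:R)%:E)%E.
Proof.
elim: n => [|n IH].
  rewrite addr0; under eq_integral do rewrite births0.
  exact: (@cond_fun i k None (fun n => n%:R)).
transitivity (\int[P]_(w in B i k) ((births n w)%:R%:E + (X n w)%:R%:E))%E.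
  by apply: eq_integral => w _; rewrite birthsS natrD.
rewrite ge0_integralD//; first last.
- by apply: mEr; exact: (mnat (fun n => n%:R)).
- by apply: mEr; exact: (mnat (fun n => n%:R)).
rewrite IH (@cond_fun i k (Some n) (fun n => n%:R) 1)//.
by rewrite PB -!EFinM -EFinD -[n.+1%:R]natr1; congr EFin; ring.
Qed.

Let cond_births_mul i k n m : (n <= m)%N ->
  (\int[P]_(w in B i k) ((births n w)%:R * (X m w)%:R)%:E =
   P (B i k) * (nu + n%:R)%:E)%E.
Proof.
elim: n => [_|n IH nm].
  rewrite addr0; under eq_integral do rewrite births0.
  by rewrite (@cond_mul i k None (Some m))//= mulr1.
transitivity (\int[P]_(w in B i k) (((births n w)%:R * (X m w)%:R)%:E +
    ((X n w)%:R * (X m w)%:R)%:E))%E.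
  by apply: eq_integral => w _; rewrite birthsS natrD -EFinD mulrDl.
have m_mul (U V : T -> nat) : measurable_fun setT U -> measurable_fun setT V ->
    measurable_fun (B i k) (fun w => ((U w)%:R * (V w)%:R : R)%:E).
  move=> mU mV; apply: (mEr (f := fun w => (U w)%:R * (V w)%:R)).
  by apply: measurable_funM; exact: (mnat (fun n => n%:R)).
rewrite ge0_integralD//; [|exact: m_mul|exact: m_mul].
rewrite IH 1?ltnW// (@cond_mul i k (Some n) (Some m))//=; last first.
  by apply: contraTneq nm => -[->]; rewrite ltnn.
by rewrite PB -!EFinM -EFinD -[n.+1%:R]natr1; congr EFin; ring.
Qed.

(** Each summand X contributes its variance s2 to the variance of the sum, of
    which the mean is nu + n. *)
Let cond_births_sqr i k n :
  (\int[P]_(w in B i k) ((births n w)%:R ^+ 2)%:E =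
   P (B i k) * (j2 + (2 * nu + s2) * n%:R + n%:R ^+ 2)%:E)%E.
Proof.
elim: n => [|n IH].
  rewrite mulr0 expr0n/= !addr0; under eq_integral do rewrite births0.
  exact: (@cond_fun i k None (fun n => n%:R ^+ 2)).
transitivity (\int[P]_(w in B i k) (((births n w)%:R ^+ 2)%:E +
    (2%:E * ((births n w)%:R * (X n w)%:R)%:E + ((X n w)%:R ^+ 2)%:E)))%E.
  apply: eq_integral => w _; rewrite birthsS natrD -EFinM -!EFinD; congr EFin; ring.
have m_sq (U : T -> nat) : measurable_fun setT U ->
    measurable_fun (B i k) (fun w => ((U w)%:R ^+ 2 : R)%:E).
  by move=> mU; apply: mEr; exact: (mnat (fun n => n%:R ^+ 2)).
have m_mul : measurable_fun (B i k) (fun w => ((births n w)%:R * (X n w)%:R : R)%:E).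
  apply: (mEr (f := fun w => (births n w)%:R * (X n w)%:R)).
  by apply: measurable_funM; exact: (mnat (fun n => n%:R)).
have m_2mul : measurable_fun (B i k)
    (fun w => (2%:E * ((births n w)%:R * (X n w)%:R : R)%:E))%E.
  exact: measurable_funeM.
have prod_ge0 w : (0 <= 2%:E * ((births n w)%:R * (X n w)%:R : R)%:E)%E.
  by rewrite -EFinM lee_fin !mulr_ge0.
have sq0 (U : T -> nat) w : (0 <= ((U w)%:R ^+ 2 : R)%:E)%E.
  by rewrite lee_fin sqr_ge0.
rewrite ge0_integralD//; last 3 first.
- exact: m_sq.
- by move=> w _; rewrite adde_ge0.
- by apply: emeasurable_funD => //; exact: m_sq.
rewrite ge0_integralD//; last exact: m_sq.
rewrite ge0_integralZl_EFin//.
rewrite IH cond_births_mul// (@cond_fun i k (Some n) (fun n => n%:R ^+ 2) (s2 + 1))//.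
by rewrite PB -!EFinM -!EFinD -[n.+1%:R]natr1; congr EFin; ring.
Qed.

Definition one_step (y : nat) (w : T) : nat :=
  if (K w < y + I w)%N then births (y + I w - K w) w else 0%N.

Lemma measurable_one_step y : measurable_fun setT (one_step y).
Proof.
apply: (@measurable_bind _ _ I (fun i w =>
  if (K w < y + i)%N then births (y + i - K w) w else 0%N)) => // i.
apply: (@measurable_bind _ _ K (fun k w =>
  if (k < y + i)%N then births (y + i - k) w else 0%N)) => // k.
by case: (k < y + i)%N.
Qed.

Let one_stepE y i k w : B i k w ->
  one_step y w = if (k < y + i)%N then births (y + i - k) w else 0%N.
Proof. by rewrite /one_step => -[/= -> ->]. Qed.

Hypothesis I2 : L1 P (fun w => (I w)%:R ^+ 2 : R).

Let mu : R := \int[P]_w (I w)%:R.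
Let i2 : R := \int[P]_w (I w)%:R ^+ 2.
Let rho : R := p / (1 - p).
Let g : R := \int[P]_w (p ^+ I w).

(** The probability P(K < y + I). *)
Definition survival (y : nat) : R := 1 - p ^+ y * g.

Let pw01 n : 0 <= p ^+ n <= 1.
Proof. by rewrite exprn_ge0 ?(ltW p_gt0)// exprn_ile1 ?(ltW p_gt0) ?(ltW p_lt1). Qed.

Let L1pI : L1 P (fun w => p ^+ I w).
Proof.
apply: L1_dominated (L1_cst P 1); first exact: measurable_of_nat.
by move=> w; have /andP[? ?] := pw01 (I w); rewrite ger0_norm.
Qed.

Let L1I : L1 P (fun w => (I w)%:R : R).
Proof.
apply: L1_dominated (L1D (L1_cst P 1) I2).
  exact: (measurable_of_nat (fun n => n%:R)).
by move=> w; rewrite ger0_norm//; move: (I w)%:R => t; nra.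
Qed.

Lemma survival_01 y : 0 <= survival y <= 1.
Proof.
have g0 : 0 <= g by apply: Exp_ge0 => w; have /andP[] := pw01 (I w).
have g1 : g <= 1.
  rewrite -[leRHS](Exp_cst P); apply: le_Exp => //; first exact: L1_cst.
  by move=> w; have /andP[] := pw01 (I w).
have /andP[a0 a1] := pw01 y; rewrite /survival subr_ge0 gerBl.
by rewrite mulr_ge0// andbT mulr_ile1.
Qed.

(** Any power of the births with a quadratic conditional expectation is handled
    in the same way, so the first and second moments are treated together:
    condition on I and K, sum over K by the convolution formula,
    then integrate over I. *)
Section Moment.
Variables (r : nat) (c0 c1 c2 : R).
Hypotheses (r_gt0 : (0 < r)%N) (c0_ge0 : 0 <= c0) (c1_ge0 : 0 <= c1) (c2_ge0 : 0 <= c2).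
Hypothesis cond_births_pow : forall i k n,
  (\int[P]_(w in B i k) ((births n w)%:R ^+ r)%:E =
   P (B i k) * (c0 + c1 * n%:R + c2 * n%:R ^+ 2)%:E)%E.

Let h (s : nat) : R := \sum_(0 <= k < s) (1 - p) * p ^+ k *
  (c0 + c1 * (s - k)%:R + c2 * (s - k)%:R ^+ 2).

Let h_ge0 s : 0 <= h s.
Proof.
apply: sumr_ge0 => k _; apply: mulr_ge0.
  by rewrite mulr_ge0 ?subr_ge0 ?(ltW p_lt1)//; have /andP[] := pw01 k.
by rewrite !addr_ge0// mulr_ge0// sqr_ge0.
Qed.

Let int_one_step y :
  (\int[P]_w ((one_step y w)%:R ^+ r)%:E = \int[P]_w (h (y + I w))%:E)%E.
Proof.
have mZ D : measurable_fun D (fun w => ((one_step y w)%:R ^+ r : R)%:E).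
  apply: mEr; apply: (mnat (fun n => n%:R ^+ r)); exact: measurable_one_step.
have Z0 w : (0 <= ((one_step y w)%:R ^+ r : R)%:E)%E by rewrite lee_fin exprn_ge0.
rewrite (@integral_law _ _ _ P (fun i => h (y + i)%N))//.
rewrite (@integral_fibres _ _ _ P setT _ I)//.
apply: eq_eseriesr => i _; rewrite setTI.
rewrite (@integral_fibres _ _ _ P _ _ K)//; last exact: measurable_fibre.
rewrite (nneseries_split 0 (y + i)); last by move=> k _; exact: integral_ge0.
(* Only k < y + i counts; otherwise the population is wiped out. *)
rewrite add0n [X in (_ + X)%E]eseries0 ?adde0; last first.
  move=> k /= yk _; rewrite -[LHS]/(\int[P]_(w in B i k) _)%E integral0_eq// => w Bw.
  by rewrite (one_stepE y Bw) ltnNge yk/= expr0n gtn_eqF.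
transitivity (\sum_(0 <= k < y + i) (pI i * ((1 - p) * p ^+ k *
    (c0 + c1 * (y + i - k)%:R + c2 * (y + i - k)%:R ^+ 2)))%:E)%E.
  rewrite big_nat_cond [RHS]big_nat_cond; apply: eq_bigr => k /andP[/andP[_ ki] _].
  transitivity (\int[P]_(w in B i k) ((births (y + i - k) w)%:R ^+ r)%:E)%E.
    apply: eq_integral => w; rewrite inE => Bw.
    by rewrite (one_stepE y Bw) ki.
  by rewrite cond_births_pow PB -EFinM; congr EFin; ring.
rewrite sumEFin -mulr_sumr EFinM muleC; congr (_ * _)%E.
by rewrite /pI fineK// fin_num_measure//; exact: measurable_fibre.
Qed.

Lemma one_step_moment y : L1 P (fun w => (one_step y w)%:R ^+ r : R) /\
  \int[P]_w ((one_step y w)%:R ^+ r : R) =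
    c0 * survival y + c1 * (y%:R + mu - rho * survival y) +
    c2 * (y%:R ^+ 2 + 2 * y%:R * mu + i2 - 2 * rho * (y%:R + mu) +
          (rho + 2 * rho ^+ 2) * survival y).
Proof.
have hE w : h (y + I w) =
    (c0 + c1 * (y%:R - rho) + c2 * (y%:R ^+ 2 - 2 * rho * y%:R + (rho + 2 * rho ^+ 2))) +
    ((c1 + c2 * (2 * y%:R - 2 * rho)) * (I w)%:R +
     (c2 * (I w)%:R ^+ 2 +
      (- (p ^+ y) * (c0 - c1 * rho + c2 * (rho + 2 * rho ^+ 2))) * p ^+ I w)).
  rewrite /h geometric_convolution// natrD exprD -/rho.
  by move: (I w)%:R (p ^+ I w) (p ^+ y) => t e f; ring.
have l3 (a b : R) : L1 P (fun w => a * (I w)%:R ^+ 2 + b * p ^+ I w).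
  by apply: L1D; exact: L1Z.
have l2 (e a b : R) : L1 P (fun w => e * (I w)%:R + (a * (I w)%:R ^+ 2 + b * p ^+ I w)).
  by apply: L1D => //; exact: L1Z.
have hL1 : L1 P (fun w => h (y + I w)).
  under eq_fun do rewrite hE.
  by apply: L1D => //; exact: L1_cst.
have intE := int_one_step y; rewrite (ExpE hL1) in intE.
split.
  apply: L1_ge0 => //.
  - by apply: (mnat (fun n => n%:R ^+ r)); exact: measurable_one_step.
  - by rewrite intE ltry.
rewrite (Exp_unique intE).
under eq_Rintegral do rewrite hE.
rewrite ExpD//; last exact: L1_cst.
rewrite Exp_cst ExpD//; last exact: L1Z.
rewrite ExpZ// ExpD; [|exact: L1Z|exact: L1Z].
rewrite !ExpZ// -/mu -/i2 -/g /survival.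
by move: (p ^+ y) => f; ring.
Qed.

End Moment.

Let nu_ge0 : 0 <= nu.
Proof. by rewrite -lee_fin -J_mean integral_ge0// => w _; rewrite lee_fin. Qed.

Let j2_ge0 : 0 <= j2.
Proof. by rewrite -lee_fin -J_sqr integral_ge0// => w _; rewrite lee_fin sqr_ge0. Qed.

Hypothesis s2_ge0 : 0 <= s2.

Lemma one_step_mean y : \int[P]_w ((one_step y w)%:R : R) =
  y%:R + mu - (rho - nu) * survival y.
Proof.
have cond i k n : (\int[P]_(w in B i k) ((births n w)%:R ^+ 1)%:E =
    P (B i k) * (nu + 1 * n%:R + 0 * n%:R ^+ 2)%:E)%E.
  by rewrite mul1r mul0r addr0 -cond_births.
have [_] := one_step_moment (ltn0Sn 0) nu_ge0 ler01 (lexx 0) cond y.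
rewrite (_ : \int[P]_w _ = \int[P]_w ((one_step y w)%:R : R))// => ->.
by ring.
Qed.

Lemma one_step_moment2 y :
  L1 P (fun w => (one_step y w)%:R ^+ 2 : R) /\
  \int[P]_w ((one_step y w)%:R ^+ 2 : R) =
    y%:R ^+ 2 + (2 * (mu + nu - rho) + s2) * y%:R +
    (sqr_drift_cst mu nu rho s2 i2 + sqr_drift_survival nu rho s2 j2 * survival y).
Proof.
have c1_ge0 : 0 <= 2 * nu + s2 by rewrite addr_ge0// mulr_ge0.
have cond i k n : (\int[P]_(w in B i k) ((births n w)%:R ^+ 2)%:E =
    P (B i k) * (j2 + (2 * nu + s2) * n%:R + 1 * n%:R ^+ 2)%:E)%E.
  by rewrite mul1r cond_births_sqr.
have [h1 h2] := one_step_moment (ltn0Sn 1) j2_ge0 c1_ge0 ler01 cond y.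
by split=> //; rewrite h2 /sqr_drift_cst /sqr_drift_survival; ring.
Qed.

(** With positive probability I = i > 0 and K = 0.  On that event the mean of the
    next state is nu + y + i > y, so the next state cannot be almost surely
    at most y. *)
Lemma one_step_up y : (exists2 i, (0 < i)%N & (0 < P (I @^-1` [set i]))%E) ->
  exists2 z, (y < z)%N & (0 < P (one_step y @^-1` [set z]))%E.
Proof.
move=> [i i0 Pi]; apply: contrapT => /forall2NP noz.
have Pz z : (y < z)%N -> P (one_step y @^-1` [set z]) = 0%E.
  move=> yz; apply/eqP; have [//|/negP] := noz z.
  by rewrite lt0e measure_ge0 andbT negbK.
have yi : (0 < y + i)%N by rewrite addn_gt0 i0 orbT.
have mZ := measurable_one_step y.
have c_gt0 : 0 < pI i * (1 - p).
  rewrite mulr_gt0 ?subr_gt0// /pI fine_gt0// Pi/=.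
  by rewrite -ge0_fin_numE// fin_num_measure//; exact: measurable_fibre.
have E1 : (\int[P]_(w in B i 0) (one_step y w)%:R%:E =
    (pI i * (1 - p) * (nu + (y + i)%:R))%:E)%E.
  transitivity (\int[P]_(w in B i 0) (births (y + i) w)%:R%:E)%E.
    by apply: eq_integral => w; rewrite inE => Bw; rewrite (one_stepE y Bw) yi subn0.
  by rewrite cond_births PB expr0 mulr1 -EFinM.
have : (\int[P]_(w in B i 0) (one_step y w)%:R%:E <= \int[P]_(w in B i 0) y%:R%:E)%E.
  rewrite (@integral_fibres _ _ _ P _ _ (one_step y))//; last first.
    by apply: mEr; exact: (mnat (fun n => n%:R)).
  rewrite [leRHS](@integral_fibres _ _ _ P _ _ (one_step y))//.
  apply: lee_nneseries => [z _ _|z _]; first by apply: integral_ge0.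
  have mBz : measurable (B i 0 `&` one_step y @^-1` [set z]).
    by apply: measurableI => //; exact: measurable_fibre.
  have [yz|zy] := ltnP y z; last first.
    apply: ge0_le_integral => //.
    - by apply: mEr; exact: (mnat (fun n => n%:R)).
    - by move=> w [_ /= ->]; rewrite lee_fin ler_nat.
  rewrite null_set_integral//; first exact: integral_ge0.
    by apply: mEr; exact: (mnat (fun n => n%:R)).
  apply/eqP; rewrite eq_le measure_ge0 andbT -(Pz z yz) le_measure ?inE//.
  exact: measurable_fibre.
have -> : (\int[P]_(w in B i 0) y%:R%:E = (pI i * (1 - p) * y%:R)%:E :> \bar R)%E.
  transitivity (y%:R%:E * P (B i 0))%E; first exact: integral_cst.
  by rewrite PB expr0 mulr1 -EFinM; congr EFin; ring.
rewrite E1 lee_fin.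
have : 1 <= i%:R :> R by rewrite (ler_nat R 1).
by move: nu_ge0; rewrite natrD; nra.
Qed.

End OneStep.

(** * The mean of the stationary distribution *)

Section Immigration.
Context {d : measure_display} {T : measurableType d} {R : realType}.
Variable P : probability T R.
Variables (I_ J_ K_ : nat -> {RV P >-> nat}) (X_ : nat -> nat -> {RV P >-> nat}).

Lemma measurable_branching (y n : nat) :
  measurable_fun setT (branching I_ J_ K_ X_ (fun=> y) n).
Proof.
elim: n => [|n IH]; first exact: measurable_cst.
apply: (@measurable_bind _ _ (branching I_ J_ K_ X_ (fun=> y) n)
  (fun s => one_step (I_ n) (J_ n) (K_ n) (fun m => X_ m n) s)) => // s.
exact: measurable_one_step.
Qed.

(** If I were almost surely 0, the state 0 would be absorbing. *)
Lemma immigration_possible (I : {RV P >-> nat}) :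
  (forall n, same_law (I_ n) I) -> irreducible (branching_trans I_ J_ K_ X_) ->
  exists2 i, (0 < i)%N & (0 < P (I @^-1` [set i]))%E.
Proof.
move=> I_law irr; apply: contrapT => /forall2NP noI.
have In0 n : P.-negligible (I_ n @^-1` [set i | (0 < i)%N]).
  have -> : I_ n @^-1` [set i | (0 < i)%N] = \bigcup_i (I_ n @^-1` [set i.+1]).
    apply/seteqP; split=> [w /=|w [i _ /= -> //]].
    by case E: (I_ n w) => [//|i] _; exists i.
  apply: negligible_bigcup => i; apply/negligibleP; first exact: measurable_fibre.
  transitivity (P (I @^-1` [set i.+1])); first exact: (I_law n [set i.+1]).
  apply/eqP; have [//|/negP] := noI i.+1.
  by rewrite lt0e measure_ge0 andbT negbK.
have [n] := irr 0%N 1%N; rewrite /branching_trans.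
suff -> : P [set w | branching I_ J_ K_ X_ (fun=> 0%N) n w = 1%N] = 0%E by rewrite ltxx.
apply: measure_negligible.
  exact: (measurable_fibre [set 1%N] (measurable_branching 0 n)).
apply: negligibleS (negligible_bigcup In0) => w /= Yw.
apply: contrapT => noIw.
have I0 m : I_ m w = 0%N.
  by apply/eqP; rewrite -leqn0 leqNgt; apply/negP => I0; apply: noIw; exists m.
suff : branching I_ J_ K_ X_ (fun=> 0%N) n w = 0%N by rewrite Yw.
by elim: n {Yw} => //= n ->; rewrite I0.
Qed.

End Immigration.

Theorem theorem3p3 (d : measure_display) (T : measurableType d) (R : realType)
    (P : probability T R) (p : R)
    (I J K X : {RV P >-> nat})
    (I_ J_ K_ : nat -> {RV P >-> nat}) (X_ : nat -> nat -> {RV P >-> nat})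
    (p_gt0 : 0 < p) (p_lt1 : p < 1)
    (J_gt0 : P [set w | (0 < J w)%N] = 1%E)
    (K_geo : geometric_law p K)
    (IJK_indep : mutually_independent (fun i : 'I_3 => tnth [tuple I; J; K] i))
    (I_law : forall n, same_law (I_ n) I)
    (J_law : forall n, same_law (J_ n) J)
    (K_law : forall n, same_law (K_ n) K)
    (X_law : forall m n, same_law (X_ m n) X)
    (family_indep : mutually_independent (driving_family I_ J_ K_ X_))
    (J_moment3 : (moment P 3 J < +oo)%E)
    (I_moment3 : (moment P 3 I < +oo)%E)
    (X_mean : moment P 1 X = 1%E)
    (X_moment4 : (moment P 4 X < +oo)%E)
    (Y_irreducible : irreducible (branching_trans I_ J_ K_ X_))
    (Y_aperiodic : aperiodic (branching_trans I_ J_ K_ X_))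
    (pi : probability nat R)
    (pi_stationary : stationary (branching_trans I_ J_ K_ X_) pi) :
  let mu := fine (moment P 1 I) in
  let nu := fine (moment P 1 J) in
  let rho := fine (moment P 1 K) in
  let sigma2 := fine (var P X) in
  let theta := 2 / sigma2 * (mu + nu - rho) in
  0 < sigma2 -> theta < 0 ->
  (-1 <= theta -> mean pi = +oo%E) /\
  (theta < -1 ->
    (mean pi < +oo)%E /\
    mean pi =
      (- theta * mu / (4 * (theta + 1) * (nu - rho)) *
        (theta * sigma2 - 2 * mu + 4 * nu / theta
         + 2 * fine (var P I) / mu
         - 4 * fine (var P (fun w => (I w + J w + K w)%N))
             / (sigma2 * theta)))%:E).
Proof.
move=> mu nu rho sigma2 theta s2_gt0 theta_lt0.
have mI : measurable_fun setT I by [].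
have mJ : measurable_fun setT J by [].
have mK : measurable_fun setT K by [].
have mX : measurable_fun setT X by [].
have I2 : L1 P (fun w => (I w)%:R ^+ 2 : R) := L1_moment (isT : 2 <= 3)%N I_moment3.
have J2 : L1 P (fun w => (J w)%:R ^+ 2 : R) := L1_moment (isT : 2 <= 3)%N J_moment3.
have X2 : L1 P (fun w => (X w)%:R ^+ 2 : R) := L1_moment (isT : 2 <= 4)%N X_moment4.
have I1 := L1_of_sqr mI I2; have J1 := L1_of_sqr mJ J2; have X1 := L1_of_sqr mX X2.
have [K1 K1E] := geometric_mean p_gt0 p_lt1 mK K_geo.
have [K2 K2E] := geometric_moment2 p_gt0 p_lt1 mK K_geo.
have rhoE : rho = p / (1 - p) by rewrite /rho moment1E K1E.
have X1E : \int[P]_w ((X w)%:R : R) = 1 by rewrite -moment1E X_mean.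
have X2E : \int[P]_w ((X w)%:R ^+ 2 : R) = sigma2 + 1.
  by rewrite /sigma2 (varE mX X2) X1E; ring.
pose i2 : R := \int[P]_w (I w)%:R ^+ 2.
pose j2 : R := \int[P]_w (J w)%:R ^+ 2.
have muE : \int[P]_w ((I w)%:R : R) = mu by rewrite /mu moment1E.
have nuE : \int[P]_w ((J w)%:R : R) = nu by rewrite /nu moment1E.
(* The first step is driven by the copies with time index 0. *)
pose Xm m : T -> nat := X_ m 0%N.
have I02 : L1 P (fun w => (I_ 0%N w)%:R ^+ 2 : R).
  apply: L1_ge0; first exact: (measurable_of_nat (fun n => n%:R ^+ 2)).
    by move=> w; exact: sqr_ge0.
  rewrite (@Exp_eq_law _ _ _ P (fun n => n%:R ^+ 2) (I_ 0%N) I)//.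
  by rewrite (ExpE I2) ltry.
have I02E : \int[P]_w ((I_ 0%N w)%:R ^+ 2 : R) = i2.
  by rewrite /Rintegral (@Exp_eq_law _ _ _ P (fun n => n%:R ^+ 2) (I_ 0%N) I).
have I01E : \int[P]_w ((I_ 0%N w)%:R : R) = mu.
  by rewrite -muE /Rintegral (@Exp_eq_law _ _ _ P (fun n => n%:R) (I_ 0%N) I).
have J01E : (\int[P]_w ((J_ 0%N w)%:R%:E : \bar R) = nu%:E)%E.
  by rewrite (@Exp_eq_law _ _ _ P (fun n => n%:R) (J_ 0%N) J)// (ExpE J1) nuE.
have J02E : (\int[P]_w (((J_ 0%N w)%:R ^+ 2)%:E : \bar R) = j2%:E)%E.
  by rewrite (@Exp_eq_law _ _ _ P (fun n => n%:R ^+ 2) (J_ 0%N) J)// (ExpE J2).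
have Xm1E m : (\int[P]_w ((Xm m w)%:R%:E : \bar R) = 1%:E)%E.
  by rewrite (@Exp_eq_law _ _ _ P (fun n => n%:R) (X_ m 0%N) X)// (ExpE X1) X1E.
have Xm2E m : (\int[P]_w (((Xm m w)%:R ^+ 2)%:E : \bar R) = (sigma2 + 1)%:E)%E.
  by rewrite (@Exp_eq_law _ _ _ P (fun n => n%:R ^+ 2) (X_ m 0%N) X)// (ExpE X2) X2E.
have K0_geo k : P (K_ 0%N @^-1` [set k]) = ((1 - p) * p ^+ k)%:E.
  rewrite -K_geo; exact: (K_law 0%N [set k]).
have IK i k : P (I_ 0%N @^-1` [set i] `&` K_ 0%N @^-1` [set k]) =
    (P (I_ 0%N @^-1` [set i]) * ((1 - p) * p ^+ k)%:E)%E.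
  rewrite -K0_geo.
  exact: (@independent_pair _ _ _ P _ (driving_family I_ J_ K_ X_)
    (inl (inl (inl 0%N))) (inl (inr 0%N))).
pose idx (u : option nat) : (nat + nat + nat + nat * nat)%type :=
  if u is Some m then inr (m, 0%N) else inl (inl (inr 0%N)).
have IKS i k u v a b : u != v ->
    P (I_ 0%N @^-1` [set i] `&` K_ 0%N @^-1` [set k] `&`
       summand (J_ 0%N) Xm u @^-1` [set a] `&` summand (J_ 0%N) Xm v @^-1` [set b]) =
    (P (I_ 0%N @^-1` [set i] `&` K_ 0%N @^-1` [set k]) *
     (P (summand (J_ 0%N) Xm u @^-1` [set a]) *
      P (summand (J_ 0%N) Xm v @^-1` [set b])))%E.
  move=> uv.
  have uq : uniq [:: inl (inl (inl 0%N)); inl (inr 0%N); idx u; idx v].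
    by case: u v uv => [m|] [n|] uv //=; rewrite !inE/= !andbT;
      apply: contra uv => /eqP[->].
  have := @independent_quadruple _ _ _ P _ (driving_family I_ J_ K_ X_)
    _ _ _ _ [set i] [set k] [set a] [set b] family_indep uq.
  by case: u v {uv uq} => [m|] [n|].
pose Z := one_step (I_ 0%N) (J_ 0%N) (K_ 0%N) Xm.
have mZ y : measurable_fun setT (Z y) by exact: measurable_one_step.
pose t := survival P p (I_ 0%N).
have t01 y : 0 <= t y <= 1 by exact: survival_01.
have Z1E y : \int[P]_w ((Z y w)%:R : R) = y%:R + mu - (rho - nu) * t y.
  by rewrite rhoE -I01E; apply: (@one_step_mean _ _ _ P p _ _ _ _ _ _ _ _ _ _ _ _ nu).
have Z2E y : L1 P (fun w => (Z y w)%:R ^+ 2 : R) /\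
    \int[P]_w ((Z y w)%:R ^+ 2 : R) =
    y%:R ^+ 2 + (2 * (mu + nu - rho) + sigma2) * y%:R +
    (sqr_drift_cst mu nu rho sigma2 i2 + sqr_drift_survival nu rho sigma2 j2 * t y).
  rewrite rhoE -I01E -I02E.
  by apply: (@one_step_moment2 _ _ _ P p) => //; exact: ltW.
have up := immigration_possible I_law Y_irreducible.
have I_law0 a : P (I_ 0%N @^-1` [set a]) = P (I @^-1` [set a]) by exact: (I_law 0%N [set a]).
have Zup y : exists2 z, (y < z)%N & (0 < P (Z y @^-1` [set z]))%E.
  apply: (@one_step_up _ _ _ P p (I_ 0%N) (J_ 0%N) (K_ 0%N) Xm p_lt1
    _ _ _ _ IK IKS nu J01E Xm1E) => //.
  by have [i i0 Pi] := up; exists i => //; rewrite I_law0.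
have mu_gt0 : 0 < mu.
  have [i i0 Pi] := up; rewrite -lte_fin -muE -(ExpE I1).
  apply: (@lt_le_trans _ _ (\int[P]_(w in I @^-1` [set i]) (I w)%:R%:E)%E); last first.
    apply: ge0_subset_integral => //; first exact: measurable_fibre.
    by apply/measurable_EFinP; exact: (measurable_of_nat (fun n => n%:R)).
  rewrite (eq_integral (cst i%:R%:E)); last by move=> w; rewrite inE/= => ->.
  rewrite integral_cst; last exact: measurable_fibre.
  by apply: mule_gt0 => //; rewrite lte_fin ltr0n.
have nu_ge0 : 0 <= nu by rewrite -nuE Exp_ge0.
have rho_gt0 : 0 < rho by rewrite rhoE divr_gt0 ?subr_gt0.
have i2_ge0 : 0 <= i2 by apply: Exp_ge0 => w; exact: sqr_ge0.
have j2_ge0 : 0 <= j2 by apply: Exp_ge0 => w; exact: sqr_ge0.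
have thetaE : theta * sigma2 = 2 * (mu + nu - rho).
  by rewrite /theta mulrAC divfK// gt_eqF.
have a_lt0 : mu + nu - rho < 0.
  by rewrite -(pmulr_rlt0 _ (ltr0n R 2 : 0 < 2)) -thetaE nmulr_rlt0.
have Z2 y : L1 P (fun w => (Z y w)%:R ^+ 2 : R) by have [] := Z2E y.
have Z_sqr y := (Z2E y).2.
have pi_stat z : pi [set z] =
    (\sum_(0 <= y <oo) pi [set y] * P (Z y @^-1` [set z]))%E by exact: pi_stationary.
have meanE : mean pi = (\int[pi]_y y%:R%:E)%E by rewrite integral_pi.
have balance := affine_balance mZ pi_stat Z2 t01 Z1E Z_sqr.
have slopeE : 2 * (mu + nu - rho) + sigma2 = sigma2 * (theta + 1).
  by rewrite -thetaE; ring.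
split=> [theta_ge|theta_lt].
  have m0 : (0 <= mean pi)%E by rewrite meanE integral_ge0.
  apply/eqP; rewrite -leye_eq leNgt; apply/negP => fin.
  have pi1 : L1 pi (fun y => y%:R : R) by apply: L1_ge0 => //; rewrite -meanE.
  have [th|th] := eqVneq theta (-1).
    have slope0 : 2 * (mu + nu - rho) + sigma2 = 0 by rewrite slopeE th addNr mulr0.
    have [tauE] := balance pi1; rewrite slope0 mul0r add0r; apply/eqP.
    exact: critical_balance.
  have slope_gt0 : 0 < 2 * (mu + nu - rho) + sigma2.
    rewrite slopeE mulr_gt0// -ltrBlDr sub0r.
    by rewrite lt_neqAle eq_sym th.
  exact: (affine_mean_infinite mZ pi_stat Z2 t01 Z1E Z_sqr slope_gt0 Zup pi1).
have slope_lt0 : 2 * (mu + nu - rho) + sigma2 < 0.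
  by rewrite slopeE pmulr_rlt0// -ltrBrDr sub0r.
have pi1 : L1 pi (fun y => y%:R : R).
  exact: (affine_mean_finite mZ pi_stat Z2 t01 Z_sqr slope_lt0).
have [tauE bal] := balance pi1.
rewrite meanE (ExpE pi1); split; first exact: ltry.
rewrite (var_sum3 IJK_indep I2 J2 K2) (varE mI I2) (varE mJ J2) (varE mK K2).
rewrite muE nuE K1E K2E -rhoE; congr EFin.
exact: (balance_solution mu_gt0 a_lt0 tauE s2_gt0 thetaE theta_lt bal).
Qed.
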